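(* Let $D$ be an integral domain such that $\operatorname{Int}(D)_P=\operatorname{Int}(D_P)$ for every $t$-maximal ideal $P$ of $D$. The following are equivalent: (1) $\operatorname{Int}(D)$ is a PvMD; (2) $D$ is a PvMD and $\operatorname{Int}(D_0)$ is a Prüfer domain.
   Context: For an integral domain $D$ with quotient field $K$: $\operatorname{Int}(D)=\{g\in K[X]:g(D)\subseteq D\}$, and for a prime $P$ of $D$, $\operatorname{Int}(D)_P$ denotes the localization of $\operatorname{Int}(D)$ at $D\setminus P$. For a nonzero fractional ideal $I$: $(D:I)=\{x\in K:xI\subseteq D\}$, $I^v=(D:(D:I))$, $I^t=\bigcup\{J^v:J\subseteq I \text{ finitely generated}\}$; $I$ is a $t$-ideal if $I=(0)$ or $I=I^t$; $t\text{-Spec}(D)$ is the set of prime $t$-ideals; $t$-maximal ideals are $t$-ideals maximal among proper $t$-ideals. $D$ is a PvMD if $D_{\mathfrak m}$ is a valuation domain for all $t$-maximal $\mathfrak m$. $\Lambda_0=\{P\in t\text{-Spec}(D):\operatorname{Int}(D)_P\neq D_P[X]\}$ and $D_0=\bigcap_{P\in\Lambda_0}D_P$ (with $D_0=K$ if $\Lambda_0=\emptyset$). *)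

(* Defs.v *)
(* Integral domains are represented as (Prop-valued) subrings
   of an ambient field; all ideal-theoretic notions are defined from scratch. *)
From HB Require Import structures.
From mathcomp Require Import all_boot all_order all_algebra.
From mathcomp Require Import fraction.
Set Implicit Arguments. Unset Strict Implicit. Unset Printing Implicit Defensive.
Import GRing.Theory.
Local Open Scope ring_scope.

Section Generic.
Variable F : fieldType.
Implicit Types (A I J P m : F -> Prop).

Definition is_subring A : Prop :=
  [/\ A 0, A 1, (forall x y, A x -> A y -> A (x - y)) & (forall x y, A x -> A y -> A (x * y))].

Definition inFrac A (x : F) : Prop :=
  exists a b, [/\ A a, A b, b != 0 & x = a / b].

Definition is_ideal A I : Prop :=
  [/\ (forall x, I x -> A x), I 0, (forall x y, I x -> I y -> I (x + y))
    & (forall a x, A a -> I x -> I (a * x))].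

Definition proper A I : Prop := ~ I 1.

Definition is_prime A I : Prop :=
  [/\ is_ideal A I, proper A I & (forall a b, A a -> A b -> I (a * b) -> I a \/ I b)].

Definition is_maximal A m : Prop :=
  [/\ is_ideal A m, proper A m &
      (forall I, is_ideal A I -> proper A I -> (forall x, m x -> I x) -> forall x, I x -> m x)].

Definition colon A I : F -> Prop := fun x => forall y, I y -> A (x * y).

Definition vclos A I : F -> Prop := colon A (colon A I).

Definition span A (s : seq F) : F -> Prop :=
  fun x => exists c : nat -> F, (forall i, A (c i)) /\ x = \sum_(i < size s) c i * s`_i.

Definition tclos A I : F -> Prop :=
  fun x => exists s : seq F,
    [/\ (forall y, y \in s -> I y), (exists2 y, y \in s & y != 0) & vclos A (span A s) x].

Definition is_t_ideal A I : Prop :=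
  (forall x, I x -> x = 0) \/ (forall x, I x <-> tclos A I x).

Definition t_prime A P : Prop := is_prime A P /\ is_t_ideal A P.

Definition t_maximal A m : Prop :=
  [/\ is_ideal A m, proper A m, is_t_ideal A m &
      (forall I, is_ideal A I -> proper A I -> is_t_ideal A I ->
         (forall x, m x -> I x) -> forall x, I x -> m x)].

Definition localize A P : F -> Prop :=
  fun x => exists a s, [/\ A a, A s, ~ P s & x = a / s].

Definition is_valuation A : Prop :=
  forall x, inFrac A x -> x != 0 -> A x \/ A x^-1.

Definition PvMD A : Prop :=
  forall m, t_maximal A m -> is_valuation (localize A m).

Definition Prufer A : Prop :=
  forall m, is_maximal A m -> is_valuation (localize A m).

End Generic.

Section IntValued.
Variable K : fieldType.
Implicit Types (D P : K -> Prop).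

Definition IntD D : {poly K} -> Prop := fun g => forall x, D x -> D g.[x].

Definition IntDloc D P : {poly K} -> Prop :=
  fun g => exists h s, [/\ IntD D h, D s, ~ P s & g = h * (s^-1)%:P].

Definition polyOverP (A : K -> Prop) : {poly K} -> Prop := fun g => forall i, A g`_i.

Definition Lambda0 D P : Prop :=
  t_prime D P /\ ~ (forall g, IntDloc D P g <-> polyOverP (localize D P) g).

(* D_0 = intersection of D_P over P in Lambda0 (= K if Lambda0 is empty) *)
Definition D0 D : K -> Prop := fun x => forall P, Lambda0 D P -> localize D P x.

(* Int(D) viewed as a subring of its quotient field K(X) = {fraction {poly K}} *)
Definition IntDF D : {fraction {poly K}} -> Prop :=
  fun f => exists g, IntD D g /\ f = tofrac g.

End IntValued.

(* Main.v *)
Require Import Defs.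
From HB Require Import structures.
From mathcomp Require Import all_boot all_order all_algebra.
From mathcomp Require Import fraction.
From mathcomp Require Import boolp classical_sets.
From mathcomp Require Import ring.

(** Write [R] for [Int(D)].  Everything rests on two facts about a prime [P] with
    [Int(D_P)] not contained in [D_P[X]].  Interpolating at the powers of [x] outside [P]
    shows that [x ^+ N = 1] modulo [P] for a fixed [N], so such a [P] is a maximal ideal;
    interpolating at the powers of [t] in [P] gives [c] outside [D_P] with
    [c * t ^+ E] in [D_P] for all [t] in [P].  With these, finitely many
    [g_i] in [R] with [g_i(d)] in [P], for [P] in [Lambda0], never have [v]-closure [R].

    If [R] is a PvMD, this puts [{g | g(0) in P}] inside a [t]-maximal ideal of [R], whence
    [D] is a PvMD, and every nonzero [t]-prime [P] with [D_0] inside [D_P] lies in [Lambda0].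
    By Zorn's lemma the latter gives, for each nonzero [a], uniform exponents such that
    [(x ^+ m.+1 - x) ^+ e] is in [a D_Q] for all [Q] in [Lambda0]; so finitely many elements of
    [R] with [v]-closure [R] generate the unit ideal of [Int(D_0)], which is thus Pruefer.

    Conversely let [M] be [t]-maximal in [R] and [P] its contraction to [D].  If [D_0] is
    inside [D_P], then [R_M] is an overring of the Pruefer domain [Int(D_0)].  Otherwise a
    finitely generated [J] inside [P] avoids all of [Lambda0], and then [M] contains no
    polynomial over [D] whose content is not in [P]: [R_M] is the Gauss extension of [D_P]. *)

Import Defs.
Set Implicit Arguments. Unset Strict Implicit. Unset Printing Implicit Defensive.
Import GRing.Theory.
Local Open Scope ring_scope.

(** * Subrings of a field, closure operators and [t]-maximal ideals *)

Section Subrings.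
Variables (F : fieldType) (A : F -> Prop).
Hypothesis HA : is_subring A.

Lemma subring0 : A 0. Proof. by case: HA. Qed.
Lemma subring1 : A 1. Proof. by case: HA. Qed.
Lemma subringB x y : A x -> A y -> A (x - y). Proof. by case: HA => _ _ h _; exact: h. Qed.
Lemma subringM x y : A x -> A y -> A (x * y). Proof. by case: HA => _ _ _; apply. Qed.
Lemma subringN x : A x -> A (- x).
Proof. by move=> Ax; rewrite -sub0r; apply: subringB => //; exact: subring0. Qed.
Lemma subringD x y : A x -> A y -> A (x + y).
Proof. by move=> Ax Ay; rewrite -[y]opprK; apply: subringB => //; exact: subringN. Qed.
Lemma subringX x n : A x -> A (x ^+ n).
Proof.
move=> Ax; elim: n => [|n IHn]; first by rewrite expr0; exact: subring1.
by rewrite exprS; exact: subringM.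
Qed.
Lemma subring_sum (I : Type) (r : seq I) (P : pred I) (f : I -> F) :
  (forall i, P i -> A (f i)) -> A (\sum_(i <- r | P i) f i).
Proof. by move=> Af; apply: big_ind => //; [exact: subring0 | exact: subringD]. Qed.
Lemma subring_prod (I : eqType) (r : seq I) (f : I -> F) :
  (forall i, i \in r -> A (f i)) -> A (\prod_(i <- r) f i).
Proof.
by move=> Af; rewrite big_seq; apply: big_ind => //; [exact: subring1 | exact: subringM].
Qed.

Lemma prime_ideal I : is_prime A I -> is_ideal A I. Proof. by case. Qed.

Lemma ideal_sub I x : is_ideal A I -> I x -> A x.
Proof. by case=> h _ _ _; exact: h. Qed.
Lemma ideal0 I : is_ideal A I -> I 0. Proof. by case. Qed.
Lemma idealD I x y : is_ideal A I -> I x -> I y -> I (x + y).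
Proof. by case=> _ _ h _; exact: h. Qed.
Lemma idealMl I a x : is_ideal A I -> A a -> I x -> I (a * x).
Proof. by case=> _ _ _ h; exact: h. Qed.
Lemma idealMr I a x : is_ideal A I -> A a -> I x -> I (x * a).
Proof. by move=> HI Aa Ix; rewrite mulrC; exact: idealMl. Qed.
Lemma idealN I x : is_ideal A I -> I x -> I (- x).
Proof. by move=> HI Ix; rewrite -mulN1r; apply: idealMl => //; apply: subringN; exact: subring1. Qed.
Lemma idealB I x y : is_ideal A I -> I x -> I y -> I (x - y).
Proof. by move=> HI Ix Iy; apply: idealD => //; exact: idealN. Qed.

Lemma primeX P x n : is_prime A P -> A x -> P (x ^+ n) -> P x.
Proof.
case=> HI P1 PM Ax; elim: n => [|n IHn]; first by rewrite expr0 => /P1.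
by rewrite exprS => /(PM _ _ Ax (subringX n Ax)) [].
Qed.

Lemma prime_neq0 P x : is_prime A P -> ~ P x -> x != 0.
Proof. by case=> HI _ _ nPx; apply/eqP=> x0; apply: nPx; rewrite x0; exact: ideal0 HI. Qed.

Lemma primeM_notin P x y : is_prime A P -> A x -> A y -> ~ P x -> ~ P y -> ~ P (x * y).
Proof. by case=> _ _ h Ax Ay nx ny /(h _ _ Ax Ay) []. Qed.

Section Localization.
Variable P : F -> Prop.
Hypothesis HP : is_prime A P.
Let HI : is_ideal A P. Proof. by case: HP. Qed.

Lemma prime_notin1 : ~ P 1. Proof. by case: HP. Qed.

Lemma sub_localize x : A x -> localize A P x.
Proof. by move=> Ax; exists x, 1; split=> //; [exact: subring1 | exact: prime_notin1 | rewrite divr1]. Qed.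

Lemma localize_inv x : A x -> ~ P x -> localize A P x^-1.
Proof. by move=> Ax nPx; exists 1, x; split=> //; [exact: subring1 | rewrite div1r]. Qed.

Lemma localize_subring : is_subring (localize A P).
Proof.
split; [by apply: sub_localize; exact: subring0 | by apply: sub_localize; exact: subring1 | |].
- move=> _ _ [a [s [Aa As nPs ->]]] [b [t [Ab At nPt ->]]].
  exists (a * t - b * s), (s * t); split.
  + by apply: subringB; exact: subringM.
  + exact: subringM.
  + exact: primeM_notin.
  + by rewrite -mulNr addf_div ?mulNr //; exact: prime_neq0 HP _.
- move=> _ _ [a [s [Aa As nPs ->]]] [b [t [Ab At nPt ->]]].
  exists (a * b), (s * t); split; [exact: subringM | exact: subringM | exact: primeM_notin |].
  by rewrite mulf_div.
Qed.

Lemma localize_num x s : A s -> ~ P s -> localize A P (s * x) -> localize A P x.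
Proof.
move=> As nPs Lsx; have -> : x = s^-1 * (s * x).
  by rewrite mulKf //; exact: prime_neq0 HP nPs.
by case: localize_subring => _ _ _; apply=> //; exact: localize_inv.
Qed.

Lemma localize_clear x : localize A P x -> exists s, [/\ A s, ~ P s & A (s * x)].
Proof.
case=> a [s [Aa As nPs ->]]; exists s; split=> //.
by rewrite mulrC divfK //; exact: prime_neq0 HP nPs.
Qed.

Lemma localize_clear_seq (r : seq F) : (forall x, x \in r -> localize A P x) ->
  exists s, [/\ A s, ~ P s & forall x, x \in r -> A (s * x)].
Proof.
elim: r => [|y r IHr] Lr.
  by exists 1; split=> //; [exact: subring1 | exact: prime_notin1].
have [x xr|s [As nPs sr]] := IHr; first by apply: Lr; rewrite inE xr orbT.
have [t [At nPt ty]] := localize_clear (Lr y (mem_head _ _)).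
exists (s * t); split; [exact: subringM | exact: primeM_notin | move=> x].
rewrite inE => /predU1P[-> | xr]; first by rewrite -mulrA; exact: subringM.
by rewrite mulrAC mulrC; apply: subringM => //; exact: sr.
Qed.

(* [P A_P] contracts to [P]. *)
Lemma prime_contract p z : P p -> localize A P z -> A (p * z) -> P (p * z).
Proof.
move=> Pp [a [s [Aa As nPs ->]]] Apz.
have : P (s * (p * (a / s))).
  rewrite mulrA mulrC mulrA divfK ?mulrA; last exact: prime_neq0 HP nPs.
  by rewrite mulrC; apply: idealMr.
by case: HP => _ _ h /(h _ _ As Apz) [].
Qed.

End Localization.

Lemma localize_mono P Q x : (forall y, A y -> P y -> Q y) -> localize A Q x -> localize A P x.
Proof. by move=> PQ [a [s [Aa As nQs ->]]]; exists a, s; split=> // /(PQ _ As). Qed.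

End Subrings.

(** * Closure operators on finite lists, and maximal closed ideals *)

Section Closure.
Variables (F : fieldType) (A : F -> Prop) (cl : seq F -> F -> Prop).

Definition allin (s : seq F) (X : F -> Prop) := forall y, y \in s -> X y.

Hypothesis cl_ext : forall s x, allin s A -> x \in s -> cl s x.
Hypothesis cl_trans : forall s t x, (forall y, y \in s -> cl t y) -> cl s x -> cl t x.
Hypothesis cl_ideal : forall s, allin s A -> is_ideal A (cl s).
Hypothesis cl_mul : forall s b x, allin s A -> A b -> cl s x -> cl (map ( *%R b) s) (b * x).

Definition clset (X : F -> Prop) x := exists2 s, allin s X & cl s x.

Definition clclosed (X : F -> Prop) := forall s x, allin s X -> cl s x -> X x.

Lemma allin_cat (s t : seq F) X : allin s X -> allin t X -> allin (s ++ t) X.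
Proof. by move=> sX tX y; rewrite mem_cat => /orP[/sX | /tX]. Qed.

Lemma cl_sub s t x : allin t A -> {subset s <= t} -> cl s x -> cl t x.
Proof. by move=> tA st; apply: cl_trans => y /st; exact: cl_ext. Qed.

Lemma clset_sub (X : F -> Prop) x : (forall x, X x -> A x) -> X x -> clset X x.
Proof.
move=> XA Xx; have sX : allin [:: x] X by move=> y; rewrite inE => /eqP->.
by exists [:: x] => //; apply: cl_ext; [move=> y /sX/XA | rewrite inE].
Qed.

Lemma clset_fin (X : F -> Prop) s : (forall x, X x -> A x) -> allin s (clset X) ->
  exists2 t, allin t X & allin s (cl t).
Proof.
move=> XA; elim: s => [|y s IHs] sX; first by exists [::].
have [z zs|t tX st] := IHs; first by apply: sX; rewrite inE zs orbT.
have [u uX uy] := sX y (mem_head _ _).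
have tuX := allin_cat tX uX; exists (t ++ u) => // z.
have tuA : allin (t ++ u) A by move=> w /tuX/XA.
rewrite inE => /predU1P[->|/st].
  by apply: cl_sub uy => // w wu; rewrite mem_cat wu orbT.
by apply: cl_sub => // w wu; rewrite mem_cat wu.
Qed.

Lemma clset_closed X : (forall x, X x -> A x) -> clclosed (clset X).
Proof.
by move=> XA s x /(clset_fin XA) [t tX st] sx; exists t => //; exact: cl_trans st sx.
Qed.

Lemma clclosed_ideal X : (forall x, X x -> A x) -> clclosed X -> is_ideal A X.
Proof.
move=> XA Xcl; split=> //.
- by apply: (Xcl [::]) => //; apply: (ideal0 (cl_ideal _)).
- move=> x y Xx Xy; have sX : allin [:: x; y] X by move=> z; rewrite !inE => /orP[] /eqP->.
  have sA : allin [:: x; y] A by move=> z /sX/XA.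
  by apply: Xcl sX _; apply: (idealD (cl_ideal sA)); apply: cl_ext; rewrite // !inE eqxx ?orbT.
- move=> a x Aa Xx; have sX : allin [:: x] X by move=> z; rewrite !inE => /eqP->.
  have sA : allin [:: x] A by move=> z /sX/XA.
  by apply: Xcl sX _; apply: (idealMl (cl_ideal sA)) => //; apply: cl_ext; rewrite ?inE.
Qed.

Lemma clset_inA X x : (forall x, X x -> A x) -> clset X x -> A x.
Proof. by move=> XA [s sX]; apply: ideal_sub; apply: cl_ideal => y /sX/XA. Qed.

(** Serves for ideal spans, for [v]-closures and for the closure defined by the primes in [Lambda0].
    A maximal admissible set is closed because its closure is still admissible. It is prime: if a
    list from [M] and [a] has 1 in its closure and [a * b] is in [M], multiplying that list by [b]
    puts [b] in [M]. *)
Lemma exists_max_closed (X : F -> Prop) : (forall x, X x -> A x) ->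
  (forall s, allin s X -> ~ cl s 1) ->
  exists M : F -> Prop, [/\ forall x, X x -> M x, clclosed M, is_prime A M &
    forall I : F -> Prop, (forall x, I x -> A x) -> clclosed I -> ~ I 1 ->
       (forall x, M x -> I x) -> forall x, I x -> M x].
Proof.
move=> XA Xcl.
(* [good] joins [X] to [I] instead of asking that [I] contain [X], so that the union of the empty
   chain is good as well. *)
pose good (I : F -> Prop) := (forall x, I x -> A x) /\
  forall s, allin s (fun x => X x \/ I x) -> ~ cl s 1.
have [] := @Zorn_bigcup F good.
  move=> G Ggood Gtot; split=> [x [I GI Ix] | s sG]; first by have [h _] := Ggood _ GI; exact: h.
  suff [sX | [I GI sI]] : allin s X \/ exists2 I, G I & allin s (fun x => X x \/ I x).
  - exact: Xcl.
  - by have [_] := Ggood _ GI; apply.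
  elim: s sG => [|y s IHs] sG; first by left.
  have ysG : allin s (fun x => X x \/ (\bigcup_(I in G) I)%classic x).
    by move=> z zs; apply: sG; rewrite inE zs orbT.
  have [Xy | [J GJ Jy]] := sG y (mem_head _ _); case: (IHs ysG) => [sX | [I GI sI]].
  - by left=> z; rewrite inE => /predU1P[->|/sX].
  - by right; exists I => // z; rewrite inE => /predU1P[->|/sI //]; left.
  - by right; exists J => // z; rewrite inE => /predU1P[->|/sX]; [right | left].
  - case: (Gtot _ _ GI GJ) => sub; right.
      exists J => // z; rewrite inE => /predU1P[->|/sI []]; [by right|by left|].
      by move=> Iz; right; exact: sub.
    exists I => // z; rewrite inE => /predU1P[->|/sI //]; right; exact: sub.
move=> M [[MA Mcl] Mmax].
have maxM I : good I -> (forall x, M x -> I x) -> forall x, I x -> M x.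
  move=> gI MI x Ix; apply: contrapT => nMx; apply: (Mmax I) => //; split=> // IM.
  exact/nMx/IM.
have XM x : X x -> M x.
  move=> Xx; apply: (maxM (fun x => X x \/ M x)); [split | by right | by left].
    by move=> y [/XA|/MA].
  by move=> s sI; apply: Mcl => y /sI [|[]]; [left | left | right].
have {}Mcl s : allin s M -> ~ cl s 1 by move=> sM; apply: Mcl => y /sM; right.
have closedM I : (forall x, I x -> A x) -> clclosed I -> ~ I 1 ->
    (forall x, M x -> I x) -> forall x, I x -> M x.
  move=> IA Icl nI1 MI; apply: maxM => //; split=> // s sI s1; apply: nI1.
  by apply: Icl s1 => y /sI [/XM/MI|].
have clM : clclosed M.
  move=> s x sM sx; apply: (closedM (clset M)).
  - by move=> y; exact: clset_inA.
  - exact: clset_closed.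
  - by case=> t /Mcl.
  - by move=> y; exact: clset_sub.
  - by exists s.
exists M; split=> //; split; [exact: clclosed_ideal | |].
  move=> M1; apply: (Mcl [:: 1]); first by move=> y; rewrite inE => /eqP->.
  by apply: cl_ext; rewrite ?inE // => y; rewrite inE => /eqP->; exact: MA.
move=> a b Aa Ab Mab; apply: contrapT => /not_orP[nMa nMb].
pose Ma x := M x \/ x = a.
have MaA x : Ma x -> A x by case=> [/MA|->].
have [t tMa t1] : clset Ma 1.
  apply: contrapT => n1; apply/nMa/(closedM (clset Ma)) => //.
  - by move=> y; exact: clset_inA.
  - exact: clset_closed.
  - by move=> y My; apply: clset_sub => //; left.
  - by apply: clset_sub => //; right.
have tA : allin t A by move=> y /tMa/MaA.
apply: nMb; rewrite -[b]mulr1; apply: (clM _ _ _ (cl_mul tA Ab t1)) => _ /mapP[y /tMa [My|->] ->].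
  by apply: (idealMl (clclosed_ideal MA clM)).
by rewrite mulrC.
Qed.

End Closure.

(** * Ideals and [v]-closures generated by finite lists *)

Section SpanClosure.
Variables (F : fieldType) (A : F -> Prop).
Hypothesis HA : is_subring A.

Lemma span_cons y s x :
  span A (y :: s) x <-> exists c z, [/\ A c, span A s z & x = c * y + z].
Proof.
split=> [[c [Ac ->]] | [c [_ [Ac [d [Ad ->]] ->]]]].
  exists (c 0%N), (\sum_(i < size s) c i.+1 * s`_i); split=> //.
    by exists (fun i => c i.+1).
  by rewrite big_ord_recl.
exists (fun i => if i is j.+1 then d j else c); split; first by case.
by rewrite big_ord_recl.
Qed.

Lemma span_least s (I : F -> Prop) x : I 0 -> (forall x y, I x -> I y -> I (x + y)) ->
  (forall a y, A a -> y \in s -> I (a * y)) -> span A s x -> I x.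
Proof.
move=> I0 ID IM [c [Ac ->]]; apply: big_ind => // i _.
by apply: IM => //; exact: mem_nth.
Qed.

Lemma span_sub_ideal s I x : is_ideal A I -> allin s I -> span A s x -> I x.
Proof.
move=> HI sI; apply: span_least; [exact: ideal0 HI | by move=> x1 y1; exact: (idealD HI)|].
by move=> a y Aa /sI; exact: (idealMl HI).
Qed.

Lemma spanD s x y : span A s x -> span A s y -> span A s (x + y).
Proof.
move=> [c [Ac ->]] [d [Ad ->]]; exists (fun i => c i + d i); split=> [i|].
  exact: subringD.
by rewrite -big_split; apply: eq_bigr => i _; rewrite mulrDl.
Qed.

Lemma spanM s a x : A a -> span A s x -> span A s (a * x).
Proof.
move=> Aa [c [Ac ->]]; exists (fun i => a * c i); split=> [i|]; first exact: subringM.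
by rewrite mulr_sumr; apply: eq_bigr => i _; rewrite mulrA.
Qed.

Lemma span0 s : span A s 0.
Proof.
exists (fun=> 0); split=> [_|]; first exact: subring0.
by rewrite big1 // => i _; rewrite mul0r.
Qed.

Lemma span_ext s x : x \in s -> span A s x.
Proof.
elim: s => // y s IHs; rewrite inE => /predU1P[->|/IHs sx]; apply/span_cons.
  by exists 1, 0; rewrite mul1r addr0; split=> //; [exact: subring1 | exact: span0].
by exists 0, x; rewrite mul0r add0r; split=> //; exact: subring0.
Qed.

Lemma span_ideal s : allin s A -> is_ideal A (span A s).
Proof.
move=> sA; split; [|exact: span0|exact: spanD|by move=> a x1; exact: spanM].
move=> x; apply: span_least; [exact: subring0 | by move=> x1 y1; exact: subringD |].
by move=> a y Aa /sA; exact: subringM.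
Qed.

Lemma exists_maximal I : is_ideal A I -> proper A I ->
  exists2 M, is_maximal A M & forall x, I x -> M x.
Proof.
move=> HI I1; have IA := ideal_sub HI.
have [|||||M [IM Mcl Mprime Mmax]] := @exists_max_closed F A (span A) _ _ _ _ I IA.
- by move=> s x _; exact: span_ext.
- move=> s t x st; apply: span_least; [exact: span0 | by move=> x1 y1; exact: spanD|].
  by move=> a y Aa /st; exact: spanM.
- exact: span_ideal.
- move=> s b x _ Ab [c [Ac ->]]; exists c; split=> //; rewrite size_map mulr_sumr.
  by apply: eq_bigr => i _; rewrite (nth_map 0) // mulrCA.
- by move=> s sI s1; apply: I1; apply: span_sub_ideal s1.
exists M => //; split; [by case: Mprime | by case: Mprime |].
move=> J HJ J1 MJ; apply: Mmax => //; first by move=> x; exact: ideal_sub HJ.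
by move=> s x; exact: span_sub_ideal.
Qed.

(* [vfin s] is the [v]-closure [vclos A (span A s)], see [vclos_span]. *)
Definition vfin (s : seq F) x := forall z, (forall y, y \in s -> A (z * y)) -> A (z * x).

Lemma vclos_span s x : vclos A (span A s) x <-> vfin s x.
Proof.
have E z : colon A (span A s) z <-> (forall y, y \in s -> A (z * y)).
  split=> [h y ys | h y]; first by apply: h; exact: span_ext.
  move=> [c [Ac ->]]; rewrite mulr_sumr; apply: subring_sum => // i _.
  by rewrite mulrCA; apply: subringM => //; apply: h; exact: mem_nth.
by split=> h z; [move=> /E hz; rewrite mulrC | move=> /E hz; rewrite mulrC]; exact: h.
Qed.

Lemma vfin_ext s x : x \in s -> vfin s x.
Proof. by move=> xs z; apply. Qed.

Lemma vfin_trans s t x : (forall y, y \in s -> vfin t y) -> vfin s x -> vfin t x.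
Proof. by move=> st sx z zt; apply: sx => y /st; apply. Qed.

Lemma vfin_ideal s : allin s A -> is_ideal A (vfin s).
Proof.
move=> sA; split.
- by move=> x sx; rewrite -[x]mul1r; apply: sx => y ys; rewrite mul1r; exact: sA.
- by move=> z _; rewrite mulr0; exact: subring0.
- by move=> x y sx sy z zs; rewrite mulrDr; apply: subringD; [| exact: sx | exact: sy].
- by move=> a x Aa sx z zs; rewrite mulrCA; apply: subringM => //; exact: sx.
Qed.

Lemma vfin_mul s b x : A b -> vfin s x -> vfin (map ( *%R b) s) (b * x).
Proof.
move=> Ab sx z zs; rewrite mulrA; apply: sx => y ys; rewrite -mulrA; apply: zs.
exact: map_f.
Qed.

Lemma vfin_sub s t x : {subset s <= t} -> vfin s x -> vfin t x.
Proof. by move=> st; apply: vfin_trans => y /st; exact: vfin_ext. Qed.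

Definition tclosed (I : F -> Prop) := forall s x, allin s I -> vfin s x -> I x.

Lemma tclosed_ideal_t I : is_ideal A I -> tclosed I -> is_t_ideal A I.
Proof.
move=> HI Icl; have [[y Iy y0]|I0] := EM (exists2 y, I y & y != 0).
  right=> x; split=> [Ix | [s [sI _ /vclos_span]]]; last exact: Icl.
  exists [:: x; y]; split; first by move=> z; rewrite !inE => /orP[]/eqP->.
    by exists y; rewrite // !inE eqxx orbT.
  by apply/vclos_span; apply: vfin_ext; rewrite mem_head.
by left=> x Ix; apply/eqP; apply: contrapT => /negP x0; apply: I0; exists x.
Qed.

(** [tclos] only sees lists with a nonzero entry, [tclosed] all lists. The [v]-closure of a list of
    zeros consists of the elements all of whose multiples in [F] lie in [A]; the element [z] outside
    [A] forces them to vanish. *)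
Lemma t_ideal_tclosed I z : (forall x, inFrac A x) -> ~ A z -> is_ideal A I ->
  is_t_ideal A I -> tclosed I.
Proof.
move=> frA nAz HI tI s x sI sx.
have [[y Iy y0]|I0] := EM (exists2 y, I y & y != 0).
  case: tI => [I0|->]; first by move: y0; rewrite (I0 y Iy) eqxx.
  exists (y :: s); split; first by move=> w; rewrite inE => /predU1P[->|/sI].
    by exists y; rewrite ?mem_head.
  by apply/vclos_span; apply: vfin_sub sx => w ws; rewrite inE ws orbT.
have sz y : y \in s -> y = 0.
  by move=> /sI Iy; apply/eqP; apply: contrapT => /negP y0; apply: I0; exists y.
have x0 : x = 0.
  apply/eqP; apply: contrapT => /negP x0; apply: nAz.
  have -> : z = (z / x) * x by rewrite divfK.
  by apply: sx => y /sz ->; rewrite mulr0; exact: subring0.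
by rewrite x0; exact: ideal0 HI.
Qed.

End SpanClosure.

(** * Existence and primality of [t]-maximal ideals *)

Section TMaximal.
Variables (F : fieldType) (A : F -> Prop).
Hypothesis HA : is_subring A.
Hypothesis frA : forall x, inFrac A x.

(** The local-to-global principle behind most arguments below: a set of denominators contained in no
    [t]-maximal ideal has a finite list with 1 in its [v]-closure. If there is no such list, Zorn's
    lemma for the [v]-closure yields [M]. *)
Lemma tgen_or_tmax (X : F -> Prop) : (forall x, X x -> A x) ->
  (exists2 s, allin s X & vfin A s 1) \/ (exists2 M, t_maximal A M & forall x, X x -> M x).
Proof.
move=> XA; have [s1|ns1] := EM (exists2 s, allin s X & vfin A s 1); [by left | right].
(* If [A] were all of [F], the empty list would already have 1 in its [v]-closure. *)
have [z nAz] : exists z, ~ A z.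
  apply: contrapT => Aall; apply: ns1; exists [::] => // z _.
  by apply: contrapT => nA; apply: Aall; exists (z * 1).
have [|||||M [XM Mcl Mprime Mmax]] := @exists_max_closed F A (vfin A) _ _ _ _ X XA.
- by move=> s x _; exact: vfin_ext.
- by move=> s t x; exact: vfin_trans.
- by move=> s; exact: vfin_ideal.
- by move=> s b x _; exact: vfin_mul.
- by move=> s sX s1; apply: ns1; exists s.
have Mid := prime_ideal Mprime.
exists M => //; split; [by [] | by case: Mprime | exact: tclosed_ideal_t |].
move=> I HI I1 tI MI; apply: Mmax => //; first by move=> x; exact: ideal_sub HI.
exact: t_ideal_tclosed nAz HI tI.
Qed.

Hypothesis properA : exists z, ~ A z.

Lemma tmax_closed M : t_maximal A M -> tclosed A M.
Proof. by case=> HI _ tI _; case: properA => z nAz; exact: t_ideal_tclosed nAz HI tI. Qed.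

(** If [a] is outside [M], adjoining it to [M] gives a list with 1 in its [v]-closure;
    multiplication by [b] moves this list into [M], and [b] follows. *)
Lemma tmax_prime M : t_maximal A M -> is_prime A M.
Proof.
move=> tM; have Mcl := tmax_closed tM; case: tM => Mid M1 tM Mmax; split=> // a b Aa Ab Mab.
apply: contrapT => /not_orP[nMa nMb].
case: (@tgen_or_tmax (fun x => M x \/ x = a)).
- by move=> x [/(ideal_sub Mid)|->].
- case=> s sMa s1; apply: nMb; rewrite -[b]mulr1; apply: Mcl (vfin_mul Ab s1).
  move=> _ /mapP[y /sMa [My|->] ->]; first exact: idealMl Mid _ _.
  by rewrite mulrC.
- case=> N [Nid N1 tN _] MaN; apply: nMa; apply: Mmax Nid N1 tN _ _ _ => [x Mx|].
    by apply: MaN; left.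
  by apply: MaN; right.
Qed.

Lemma tmax_vfin1 M s : t_maximal A M -> allin s M -> ~ vfin A s 1.
Proof. by move=> tM sM /(tmax_closed tM sM); case: tM. Qed.

End TMaximal.

(** * Valuation rings of a field *)

Section Valuation.
Variable F : fieldType.
Implicit Types B : F -> Prop.

Definition dividing B := forall x, x != 0 -> B x \/ B x^-1.

Lemma valuation_dividing A P : is_subring A -> is_prime A P -> (forall x, inFrac A x) ->
  is_valuation (localize A P) <-> dividing (localize A P).
Proof.
move=> HA HP frA; split=> h x; last by move=> _; exact: h.
move=> x0; apply: h => //; case: (frA x) => a [b [Aa Ab b0 ->]].
by exists a, b; split=> //; exact: sub_localize.
Qed.

(** [j] is an entry of least value; it is used to normalize the content of polynomials. *)
Lemma dividing_seq B (s : seq F) : is_subring B -> dividing B -> (exists2 y, y \in s & y != 0) ->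
  exists j, [/\ j \in s, j != 0 & forall y, y \in s -> B (y / j)].
Proof.
move=> HB div; elim: s => [|x s IHs]; first by case.
have [sn0|s0] := EM (exists2 y, y \in s & y != 0).
  move=> _; have [j [js j0 sj]] := IHs sn0.
  have [x0|x0] := eqVneq x 0.
    exists j; split; rewrite ?inE ?js ?orbT // => y; rewrite inE => /predU1P[->|/sj //].
    by rewrite x0 mul0r; exact: subring0.
  have xj0 : x / j != 0 by rewrite mulf_neq0 ?invr_eq0.
  have [Bxj|Bjx] := div _ xj0.
    by exists j; split; rewrite ?inE ?js ?orbT // => y; rewrite inE => /predU1P[->|/sj].
  exists x; split; rewrite ?mem_head // => y; rewrite inE => /predU1P[->|/sj Byj].
    by rewrite divff //; exact: subring1.
  have -> : y / x = (y / j) * (x / j)^-1 by rewrite invf_div mulf_div [y * j]mulrC -mulf_div divff // mul1r.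
  exact: subringM.
move=> [x' + x'0]; rewrite inE => /orP[/eqP xx'|x's]; last by case: s0; exists x'.
subst x'; exists x; rewrite mem_head; split=> // y; rewrite inE => /predU1P[->|ys].
  by rewrite divff //; exact: subring1.
have [->|y0] := eqVneq y 0; first by rewrite mul0r; exact: subring0.
by case: s0; exists y.
Qed.

End Valuation.

Lemma fracP (R : idomainType) (h : {fraction R}) :
  exists a b : R, b != 0 /\ h = tofrac a / tofrac b.
Proof.
elim/quotW: h => x; exists (\n_x), (\d_x); split; first exact: denom_ratioP.
have d0 : tofrac (\d_x) != 0 by rewrite tofrac_eq0 denom_ratioP.
apply: (canRL (mulfK d0)).
rewrite -[LHS]/(FracField.mul _ _) !piE. apply/eqmodP. rewrite /= FracField.equivfE /FracField.mulf /=.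
by rewrite !numden_Ratio ?mulr1 ?oner_eq0 ?denom_ratioP // mulrC.
Qed.

(** * Integer-valued polynomials and localization *)

Section PolyOver.
Variables (K : fieldType) (B : K -> Prop).
Hypothesis HB : is_subring B.

Lemma polyOverP_C c : B c -> polyOverP B c%:P.
Proof. by move=> Bc i; rewrite coefC; case: ifP => // _; exact: subring0. Qed.

Lemma polyOverP_X : polyOverP B 'X.
Proof. by move=> i; rewrite coefX; case: (i == 1%N); [exact: subring1 | exact: subring0]. Qed.

Lemma polyOverP_D f g : polyOverP B f -> polyOverP B g -> polyOverP B (f + g).
Proof. by move=> Bf Bg i; rewrite coefD; exact: subringD. Qed.

Lemma polyOverP_B f g : polyOverP B f -> polyOverP B g -> polyOverP B (f - g).
Proof. by move=> Bf Bg i; rewrite coefB; exact: subringB. Qed.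

Lemma polyOverP_M f g : polyOverP B f -> polyOverP B g -> polyOverP B (f * g).
Proof.
move=> Bf Bg i; rewrite coefM; apply: subring_sum => // j _; exact: subringM.
Qed.

Lemma polyOverP_horner f x : polyOverP B f -> B x -> B f.[x].
Proof.
move=> Bf Bx; rewrite horner_coef; apply: subring_sum => // i _.
by apply: subringM => //; exact: subringX.
Qed.

Lemma polyOverP_IntD f : polyOverP B f -> IntD B f.
Proof. by move=> Bf x; exact: polyOverP_horner. Qed.

(* Newton interpolation at [a 0], ..., [a n.-1]; [w] is a common multiple of the
   differences of the nodes. *)
Lemma interpolation_coef w n (a : nat -> K) (f : {poly K}) : B w -> (size f <= n)%N ->
  (forall i, (i < n)%N -> B (a i)) ->
  (forall i j, (i < j < n)%N -> a j != a i /\ B (w / (a j - a i))) ->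
  (forall i, (i < n)%N -> B f.[a i]) -> polyOverP B ((w ^+ n)%:P * f).
Proof.
move=> Bw; elim: n a f => [|n IHn] a f szf Ba Bwa Bfa.
  by move: szf; rewrite leqn0 size_poly_eq0 => /eqP->; rewrite mulr0 => i; rewrite coef0; exact: subring0.
have /factor_theorem[g fE] : root (f - (f.[a 0%N])%:P) (a 0%N) by rewrite rootE !hornerE subrr.
have {}fE : f = (f.[a 0%N])%:P + g * ('X - (a 0%N)%:P) by rewrite -fE addrC subrK.
have szg : (size g <= n)%N.
  have [->|g0] := eqVneq g 0; first by rewrite size_poly0.
  have : (size (g * ('X - (a 0%N)%:P)%R)%R <= n.+1)%N.
    have -> : g * ('X - (a 0%N)%:P) = f - (f.[a 0%N])%:P by rewrite {1}fE [RHS]addrC addKr.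
    apply: leq_trans (size_polyD _ _) _; rewrite size_polyN geq_max szf.
    by apply: leq_trans (size_polyC_leq1 _) _.
  by rewrite size_Mmonic ?monicXsubC // size_XsubC addn2 ltnS.
have IH : polyOverP B ((w ^+ n)%:P * (w%:P * g)).
  apply: (IHn (fun i => a i.+1)).
  - by rewrite mul_polyC; apply: leq_trans (size_scale_leq _ _) _.
  - by move=> i ltin; exact: Ba.
  - by move=> i j ltijn; exact: Bwa.
  - move=> i ltin; have [nea Bwai] := Bwa 0%N i.+1 ltin; rewrite -subr_eq0 in nea.
    have -> : (w%:P * g).[a i.+1] = w / (a i.+1 - a 0%N) * (f.[a i.+1] - f.[a 0%N]).
      rewrite {1}fE !hornerE; field; exact: nea.
    by apply: subringM => //; apply: subringB => //; exact: Bfa.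
have -> : (w ^+ n.+1)%:P * f =
    (w ^+ n.+1 * f.[a 0%N])%:P + (w ^+ n)%:P * (w%:P * g) * ('X - (a 0%N)%:P).
  by rewrite {1}fE; move: (f.[a 0%N]) (a 0%N) => c e; rewrite exprSr !polyCM; ring.
apply: polyOverP_D; first by apply: polyOverP_C; apply: (subringM HB); [exact: subringX | exact: Bfa].
apply: polyOverP_M => //; apply: polyOverP_B; first exact: polyOverP_X.
by apply: polyOverP_C; exact: Ba.
Qed.

End PolyOver.

(** * Polynomials that are integer-valued at a prime *)

Section IntValuedAtPrime.
Variables (K : fieldType) (D : K -> Prop) (P : K -> Prop).
Hypothesis HD : is_subring D.
Hypothesis HP : is_prime D P.
Let HDP := localize_subring HD HP.
Let Pid := prime_ideal HP.
Implicit Type f : {poly K}.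

(** Induction on the size. The polynomial [g = s ^+ n * f - f(s * X)] still maps [D] into the
    localization and has no coefficient in degree [n]; at [d / s] its value differs from [s ^+ n *
    f.[d / s]] by [f.[d]]. *)
Lemma int_valued_localize f : (forall d, D d -> localize D P f.[d]) -> IntD (localize D P) f.
Proof.
have [n] : exists n, (size f <= n)%N by exists (size f).
elim: n f => [|n IHn] f szf Df _ [d [s [Dd Ds nPs ->]]].
  by move: szf; rewrite leqn0 size_poly_eq0 => /eqP->; rewrite horner0; exact: subring0 HDP.
pose p := \poly_(i < size f) (s ^+ i * f`_i); pose g := (s ^+ n)%:P * f - p.
have s0 := prime_neq0 HP nPs.
have gE x : g.[x] = s ^+ n * f.[x] - f.[s * x].
  rewrite /g hornerD hornerN hornerM hornerC horner_poly (horner_coef f (s * x)).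
  by congr (_ - _); apply: eq_bigr => i _; rewrite exprMn mulrCA mulrA.
have szg : (size g <= n)%N.
  apply/leq_sizeP => j; rewrite leq_eqVlt coefB coefCM coef_poly.
  case/predU1P=> [<-|ltnj].
    by case: ltnP => [_|/(nth_default 0)->]; rewrite ?subrr // mulr0 subr0.
  have fj : (size f <= j)%N by exact: leq_trans szf ltnj.
  by rewrite ltnNge fj nth_default // mulr0 subrr.
have : localize D P (s ^+ n * f.[d / s]).
  have -> : s ^+ n * f.[d / s] = g.[d / s] + f.[d] by rewrite gE mulrCA divff // mulr1 subrK.
  apply: (subringD HDP); last exact: Df.
  apply: IHn => // [x Dx|]; last by exists d, s.
  rewrite gE; apply: (subringB HDP); last by apply: Df; exact: subringM.
  apply: (subringM HDP); last exact: Df.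
    by apply: (sub_localize HD HP); exact: subringX.
by apply: (localize_num HD HP) => //; [exact: subringX | move/(primeX HD HP Ds)].
Qed.

Lemma IntD_localize (D0 : K -> Prop) f : (forall x, D x -> D0 x) ->
  (forall x, D0 x -> localize D P x) -> IntD D0 f -> IntD (localize D P) f.
Proof. by move=> DD0 D0P D0f; apply: int_valued_localize => d /DD0/D0f/D0P. Qed.

Section NotPoly.
Variable f : {poly K}.
Hypothesis Df : IntD (localize D P) f.
Hypothesis nDf : ~ polyOverP (localize D P) f.

(** [N] is the factorial of [size f]. If [x ^+ N - 1] is outside [P], so is its divisor [x ^+ k - 1]
    for [0 < k < size f]. The powers of [x] are then nodes with unit differences at [P], and
    interpolation with [w = 1] gives [f] coefficients in the localization. *)
Lemma not_poly_residue_torsion :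
  exists2 N, (0 < N)%N & forall x, D x -> ~ P x -> P (x ^+ N - 1).
Proof.
exists (size f)`!; first exact: fact_gt0.
move=> x Dx nPx; apply: contrapT => nP; apply: nDf.
have nPk k : (0 < k < size f)%N -> ~ P (x ^+ k - 1).
  move=> /andP[k0 kf] Pk; apply: nP.
  have /dvdnP[q ->] : (k %| (size f)`!)%N by apply: dvdn_fact; rewrite k0 ltnW.
  rewrite mulnC exprM subrX1; apply: idealMr Pid _ Pk; apply: subring_sum => // i _.
  by apply: subringX => //; exact: subringX.
rewrite -[f]mul1r -[1]/(1%:P) -(expr1n K (size f)).
apply: (@interpolation_coef K _ HDP 1 (size f) (fun i => x ^+ i)) => //.
- exact: subring1.
- by move=> i _; apply: (sub_localize HD HP); exact: subringX.
- move=> i j /andP[ij jf].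
  have -> : x ^+ j - x ^+ i = x ^+ i * (x ^+ (j - i) - 1).
    by rewrite mulrBr mulr1 -exprD subnKC // ltnW.
  have Du : D (x ^+ i * (x ^+ (j - i) - 1)).
    by apply: subringM; [|exact: subringX|apply: subringB; [|exact: subringX|exact: subring1]].
  have nPu : ~ P (x ^+ i * (x ^+ (j - i) - 1)).
    apply: primeM_notin HP _ _ _ _; [exact: subringX | | by move/(primeX HD HP Dx) | ].
      by apply: subringB; [|exact: subringX|exact: subring1].
    by apply: nPk; rewrite subn_gt0 ij (leq_ltn_trans (leq_subr _ _)).
  rewrite -subr_eq0 div1r; split; last exact: localize_inv.
  have -> : x ^+ j - x ^+ i = x ^+ i * (x ^+ (j - i) - 1).
    by rewrite mulrBr mulr1 -exprD subnKC // ltnW.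
  exact: prime_neq0 HP nPu.
- by move=> i _; apply: Df; apply: (sub_localize HD HP); exact: subringX.
Qed.

(** [c] is a coefficient of [f] outside the localization and [E] is the square of [n = size f]. For
    [t] in [P] the differences of the nodes [t ^+ i] are powers of [t] below [t ^+ n] up to units,
    so interpolation applies with [w = t ^+ n]. *)
Lemma not_poly_conductor : exists c E, [/\ ~ localize D P c, (0 < E)%N &
  forall t, P t -> localize D P (c * t ^+ E)].
Proof.
have /existsNP[i nDi] := nDf.
have n0 : (0 < size f)%N.
  by rewrite lt0n; apply/eqP => /size0nil f0; apply: nDi; rewrite f0 nth_nil; exact: subring0.
exists f`_i, (size f * size f)%N; split=> //; first by rewrite muln_gt0 n0.
move=> t Pt; have Dt := ideal_sub Pid Pt; have Lt : localize D P t by exact: sub_localize.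
(* The powers of 0 are not distinct nodes; this case rests on [E > 0]. *)
have [->|t0] := eqVneq t 0.
  by rewrite expr0n muln_eq0 gtn_eqF //= mulr0; exact: subring0.
suff h : polyOverP (localize D P) (((t ^+ size f) ^+ size f)%:P * f).
  by have := h i; rewrite coefCM -exprM mulrC.
apply: (@interpolation_coef K _ HDP _ _ (fun i => t ^+ i)) => //.
- exact: subringX.
- by move=> j _; exact: subringX.
- move=> j k /andP[jk kf].
  have E : t ^+ k - t ^+ j = t ^+ j * (t ^+ (k - j) - 1).
    by rewrite mulrBr mulr1 -exprD subnKC // ltnW.
  have Du : D (t ^+ (k - j) - 1) by apply: subringB; [|exact: subringX|exact: subring1].
  have nPu : ~ P (t ^+ (k - j) - 1).
    move=> Pu; apply: (prime_notin1 HP).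
    have -> : 1 = t ^+ (k - j) - (t ^+ (k - j) - 1) by rewrite opprB addrC subrK.
    apply: (idealB HD Pid) => //; have /prednK<- : (0 < k - j)%N by rewrite subn_gt0.
    rewrite exprS.
    by apply: (idealMr Pid) => //; exact: subringX.
  have u0 := prime_neq0 HP nPu.
  split; first by rewrite -subr_eq0 E mulf_neq0 // expf_neq0.
  rewrite E; have -> : t ^+ size f / (t ^+ j * (t ^+ (k - j) - 1)) =
      t ^+ (size f - j) * (t ^+ (k - j) - 1)^-1.
    rewrite -{1}(@subnK j (size f)) ?exprD; last exact: leq_trans (ltnW jk) (ltnW kf).
    by rewrite invfM mulrA mulfK // expf_neq0.
  by apply: subringM => //; [exact: subringX | exact: localize_inv].
- by move=> j _; apply: Df; exact: subringX.
Qed.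

End NotPoly.
End IntValuedAtPrime.

(** * The ring [Int(D)] inside [K(X)] *)

Section IntDRing.
Variables (K : fieldType) (D : K -> Prop).
Hypothesis HD : is_subring D.
Implicit Type g : {poly K}.

Lemma IntDF_tofrac g : IntDF D (tofrac g) <-> IntD D g.
Proof.
split=> [[h [Dh /eqP]]|Dg]; last by exists g.
by rewrite tofrac_eq => /eqP->.
Qed.

Lemma IntDB g h : IntD D g -> IntD D h -> IntD D (g - h).
Proof. by move=> Dg Dh x Dx; rewrite !hornerE; apply: subringB; [|exact: Dg|exact: Dh]. Qed.

Lemma IntDM g h : IntD D g -> IntD D h -> IntD D (g * h).
Proof. by move=> Dg Dh x Dx; rewrite hornerM; apply: subringM; [|exact: Dg|exact: Dh]. Qed.

Lemma IntDC c : IntD D c%:P <-> D c.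
Proof.
split=> [h | Dc x _]; last by rewrite hornerC.
by have := h 0 (subring0 HD); rewrite hornerC.
Qed.

Lemma IntDF_subring : is_subring (IntDF D).
Proof.
split.
- by exists 0; rewrite tofrac0; split=> // x _; rewrite horner0; exact: subring0.
- by exists 1; rewrite tofrac1; split=> // x _; rewrite hornerC; exact: subring1.
- by move=> _ _ [g [Dg ->]] [h [Dh ->]]; exists (g - h); rewrite tofracB; split=> //; exact: IntDB.
- by move=> _ _ [g [Dg ->]] [h [Dh ->]]; exists (g * h); rewrite tofracM; split=> //; exact: IntDM.
Qed.

Lemma IntD_prod (I : eqType) (r : seq I) (f : I -> {poly K}) :
  (forall i, i \in r -> IntD D (f i)) -> IntD D (\prod_(i <- r) f i).
Proof.
move=> Df x Dx; rewrite horner_prod; apply: subring_prod => // i /Df; exact.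
Qed.

Lemma IntDX g n : IntD D g -> IntD D (g ^+ n).
Proof. by move=> Dg x Dx; rewrite horner_exp; apply: subringX => //; exact: Dg. Qed.

(** [Int(D)] is never a field, even when [D] is: the inverse of [X] is not a polynomial. *)
Lemma IntDF_proper : exists z, ~ IntDF D z.
Proof.
exists (tofrac 'X)^-1; case=> g [_ gE].
have X0 : tofrac ('X : {poly K}) != 0 by rewrite tofrac_eq0 polyX_eq0.
have /eqP : tofrac (g * 'X) = 1 by rewrite tofracM -gE mulVf.
rewrite -tofrac1 tofrac_eq => /eqP/(congr1 (fun p : {poly K} => p.[0]))/eqP.
by rewrite !hornerE eq_sym oner_eq0.
Qed.

Lemma poly_clear_seq P (r : seq {poly K}) : is_prime D P ->
  (forall g, g \in r -> polyOverP (localize D P) g) ->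
  exists s, [/\ D s, ~ P s & forall g, g \in r -> polyOverP D (s%:P * g)].
Proof.
move=> HP rP; have [|s [Ds nPs sr]] := @localize_clear_seq _ _ HD _ HP (flatten [seq (g : seq K) | g <- r]).
  by move=> c /flatten_mapP[g gr /(nthP 0)[i _ <-]]; exact: rP.
exists s; split=> // g gr i; rewrite coefCM.
have [ltig|leig] := ltnP i (size g); last by rewrite nth_default // mulr0; exact: subring0.
by apply: sr; apply/flatten_mapP; exists g => //; exact: mem_nth.
Qed.

Hypothesis frD : forall x, inFrac D x.

(** The localization at this prime is [K], so common denominators over [K] become a case of those at
    a prime. *)
Lemma zero_prime : is_prime D (eq^~ 0).
Proof.
split; [split=> // | by move/eqP; rewrite oner_eq0 |].
- by move=> x ->; exact: subring0.
- by move=> x y -> ->; rewrite addr0.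
- by move=> a x _ ->; rewrite mulr0.
by move=> a b _ _ /eqP; rewrite mulf_eq0 => /orP[]/eqP; [left|right].
Qed.

Lemma localize_zero x : localize D (eq^~ 0) x.
Proof. by case: (frD x) => a [b [Da Db /eqP b0 ->]]; exists a, b. Qed.

Lemma poly_denom_seq (r : seq {poly K}) :
  exists s, [/\ D s, s != 0 & forall g, g \in r -> polyOverP D (s%:P * g)].
Proof.
have [g _ i|s [Ds /eqP s0 sr]] := @poly_clear_seq _ r zero_prime; first exact: localize_zero.
by exists s.
Qed.

Lemma IntDF_frac h : inFrac (IntDF D) h.
Proof.
have [a [b [b0 ->]]] := fracP h.
have [s [Ds s0 sr]] := poly_denom_seq [:: a; b].
have sab g : g \in [:: a; b] -> IntDF D (tofrac (s%:P * g)).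
  by move=> /sr sg; apply/IntDF_tofrac/(polyOverP_IntD HD).
have sP0 : tofrac s%:P != 0 by rewrite tofrac_eq0 polyC_eq0.
exists (tofrac (s%:P * a)), (tofrac (s%:P * b)); split.
- by apply: sab; rewrite mem_head.
- by apply: sab; rewrite !inE eqxx orbT.
- by rewrite tofrac_eq0 mulf_neq0 // polyC_eq0.
- by rewrite !tofracM -mulf_div (divff sP0) mul1r.
Qed.

End IntDRing.

(** * The primes in [Lambda0] *)

(** In effect, the powers [y ^+ E] still have 1 in their [v]-closure. Otherwise the [r] with [z * r]
    in [A] would lie in a [t]-maximal ideal, which is prime and would contain every [y]. *)
Lemma vfin_pow (F : fieldType) (A : F -> Prop) (s : seq F) (z : F) (E : nat) :
  is_subring A -> (forall x, inFrac A x) -> (exists y, ~ A y) -> allin s A -> vfin A s 1 ->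
  (forall y, y \in s -> A (z * y ^+ E)) -> A z.
Proof.
move=> HA frA prA sA s1 szE.
have [|[t tX t1]|[M tM XM]] := @tgen_or_tmax _ _ HA frA (fun r => A r /\ A (z * r)).
- by move=> r [].
- by rewrite -[z]mulr1; apply: t1 => y /tX [].
- exfalso; apply: (tmax_vfin1 HA frA prA tM _ s1) => y ys.
  apply: (primeX HA (tmax_prime HA frA prA tM) (n := E)); first exact: sA.
  by apply: XM; split; [apply: subringX => //; exact: sA | exact: szE].
Qed.

Lemma map_tofracP (R : idomainType) (s : seq {fraction R}) (Phi : R -> Prop) :
  allin s (fun h => exists2 g, Phi g & h = tofrac g) ->
  exists2 gs, s = map (@tofrac R) gs & forall g, g \in gs -> Phi g.
Proof.
elim: s => [|h s IHs] sP; first by exists [::].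
have [y ys|gs -> gsP] := IHs; first by apply: sP; rewrite inE ys orbT.
have [g Pg ->] := sP h (mem_head _ _).
by exists (g :: gs) => // f; rewrite inE => /predU1P[->|/gsP].
Qed.

Section LambdaZero.
Variables (K : fieldType) (D : K -> Prop).
Hypothesis HD : is_subring D.
Hypothesis frD : forall x, inFrac D x.
Hypothesis properD : exists z, ~ D z.
Hypothesis Hloc : forall P : K -> Prop, t_maximal D P ->
  forall g : {poly K}, IntDloc D P g <-> IntD (localize D P) g.

Local Notation R := (IntDF D).
Let HR : is_subring R := IntDF_subring HD.
Let frR : forall h, inFrac R h := IntDF_frac HD frD.
Let properR : exists z, ~ R z := IntDF_proper D.

Implicit Types P Q : K -> Prop.

Lemma tmax_t_prime Q : t_maximal D Q -> t_prime D Q.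
Proof. by move=> tQ; split; [exact: tmax_prime tQ | case: tQ]. Qed.

Lemma t_prime_tclosed P : t_prime D P -> tclosed D P.
Proof. by case: properD => z nDz [[Pid _ _] tP]; exact: t_ideal_tclosed nDz Pid tP. Qed.

(** The hypothesis [Hloc] acts through this lemma: values in the localization on [D] give values
    there on all of the localization, and [Hloc] then supplies a denominator outside [P]. *)
Lemma IntDloc_clear_seq P (gs : seq {poly K}) : t_maximal D P ->
  (forall g, g \in gs -> forall d, D d -> localize D P g.[d]) ->
  exists s, [/\ D s, ~ P s & forall g, g \in gs -> IntD D (s%:P * g)].
Proof.
move=> tP; have HP := tmax_prime HD frD properD tP.
elim: gs => [|g gs IHgs] gsP.
  by exists 1; split=> //; [exact: subring1 | exact: prime_notin1 HP].
have [f fgs|s [Ds nPs sgs]] := IHgs; first by apply: gsP; rewrite inE fgs orbT.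
have /(Hloc tP)[h [t [Dh Dt nPt gE]]] : IntD (localize D P) g.
  by apply: int_valued_localize => //; apply: gsP; exact: mem_head.
exists (s * t); split; [exact: subringM | exact: primeM_notin HP _ _ _ _ | move=> f].
rewrite inE polyCM => /predU1P[->|fgs].
  rewrite gE -mulrA [h * _]mulrC [X in _ * X]mulrA -polyCM mulfV ?mul1r; last exact: prime_neq0 HP nPt.
  by apply: IntDM => //; apply/IntDC.
rewrite -mulrA mulrCA; apply: IntDM => //; last exact: sgs.
exact/IntDC.
Qed.

(** Clearing denominators puts [D_P[X]] inside [Int(D)_P], so a difference between the two comes
    from a member of [Int(D)_P], and such a member is integer-valued on [D_P]. *)
Lemma lambda0_not_poly P : Lambda0 D P ->
  exists2 f, IntD (localize D P) f & ~ polyOverP (localize D P) f.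
Proof.
case=> [[HP tP]] /existsNP[g ng]; have HDP := localize_subring HD HP.
have [Dg|nDg] := EM (polyOverP (localize D P) g).
  case: ng; split=> // _.
  have [f|s [Ds nPs sg]] := @poly_clear_seq _ _ HD P [:: g] HP; first by rewrite inE => /eqP->.
  exists (s%:P * g), s; split=> //; first by apply: polyOverP_IntD => //; apply: sg; exact: mem_head.
  by rewrite mulrC mulrA -polyCM mulVf ?mul1r //; exact: prime_neq0 HP nPs.
exists g => //; have [|] := EM (IntDloc D P g); last by move=> h; case: ng.
case=> h [s [Dh Ds nPs ->]]; apply: int_valued_localize => // d Dd.
rewrite hornerM hornerC; apply: (subringM HDP); last exact: localize_inv.
by apply: (sub_localize HD HP); exact: Dh.
Qed.

Lemma not_lambda0_poly P f : t_prime D P -> ~ Lambda0 D P -> IntD D f ->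
  polyOverP (localize D P) f.
Proof.
move=> tP nL Df; have [HP _] := tP.
have h : forall g, IntDloc D P g <-> polyOverP (localize D P) g.
  by apply: contrapT => h; apply: nL.
apply/h; exists f, 1; split=> //; [exact: subring1 | exact: prime_notin1 HP |].
by rewrite invr1 mulr1.
Qed.

Lemma lambda0_torsion P : Lambda0 D P ->
  exists2 N, (0 < N)%N & forall x, D x -> ~ P x -> P (x ^+ N - 1).
Proof.
move=> LP; have [f Df nDf] := lambda0_not_poly LP; case: LP => [[HP _] _].
exact: not_poly_residue_torsion Df nDf.
Qed.

(** [P] is even a maximal ideal: an ideal containing [P] and some [x] outside [P] contains both
    [x ^+ N] and [x ^+ N - 1]. *)
Lemma lambda0_tmax P : Lambda0 D P -> t_maximal D P.
Proof.
move=> LP; have [N N0 PN] := lambda0_torsion LP; case: LP => [[[Pid P1 PM] tP] _].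
split=> // I Iid I1 _ PI x Ix; apply: contrapT => nPx; apply: I1.
have Dx := ideal_sub Iid Ix.
have -> : 1 = x ^+ N - (x ^+ N - 1) by rewrite opprB addrC subrK.
apply: (idealB HD Iid); last by apply: PI; exact: PN.
by rewrite -(prednK N0) exprS; apply: (idealMr Iid) => //; exact: subringX.
Qed.

(* With [x ^+ N = 1] on the nonzero residues at [Q], every [g_i] takes values in [Q] after
   multiplication by [G = \prod_i (1 - g_i ^+ N)], while [G d] is a unit at [Q].  If
   [c] is not in [D_Q] but [c * t ^+ E] is for all [t] in [Q], then [c * G ^+ E]
   multiplies every [g_i ^+ E] into [Int(D_Q)]. *)
Lemma lambda0_eval Q (gs : seq {poly K}) d : Lambda0 D Q -> D d ->
  (forall g, g \in gs -> IntD D g) -> (forall g, g \in gs -> Q g.[d]) ->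
  ~ vfin R (map (@tofrac _) gs) 1.
Proof.
move=> LQ Dd gsD gsQ gs1; have tQ := lambda0_tmax LQ.
have HQ := tmax_prime HD frD properD tQ; have Qid := prime_ideal HQ.
have [N N0 QN] := lambda0_torsion LQ; have [f Df nDf] := lambda0_not_poly LQ.
have [c [E [nDc E0 cE]]] := not_poly_conductor HD HQ Df nDf.
pose G : {poly K} := \prod_(g <- gs) (1 - g ^+ N).
have D1 : IntD D 1 by move=> x _; rewrite hornerC; exact: subring1.
have DG : IntD D G by apply: IntD_prod => // g /gsD Dg; apply: IntDB => //; exact: IntDX.
have GgQ g x : g \in gs -> D x -> Q (G * g).[x].
  move=> ggs Dx; rewrite /G (big_rem g) //= mulrAC hornerM.
  apply: (idealMr Qid); last first.
    rewrite !hornerE; have Dgx := gsD _ ggs _ Dx.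
    have [Qgx|nQgx] := EM (Q g.[x]).
      by apply: (idealMl Qid) => //; apply: (subringB HD); [exact: subring1 | exact: subringX].
    by apply: (idealMr Qid) => //; rewrite -opprB; apply: (idealN HD Qid); exact: QN.
  by apply: IntD_prod Dx => // h /mem_rem/gsD Dh; apply: IntDB => //; exact: IntDX.
have [|s [Ds nQs sgs]] :=
    @IntDloc_clear_seq Q [seq c%:P * (G * g) ^+ E | g <- gs] tQ.
  by move=> _ /mapP[g ggs ->] x Dx; rewrite hornerM hornerC horner_exp; apply: cE; exact: GgQ.
(* [vfin_pow] strips the factors [g ^+ E]. Evaluating the result at [d], where [G] takes a value
   outside [Q], puts [c] in the localization. *)
have : R (tofrac (s%:P * (c%:P * G ^+ E))).
  apply: (vfin_pow HR frR properR (s := map (@tofrac _) gs) (E := E)) => //.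
    by move=> _ /mapP[g /gsD Dg ->]; exact/IntDF_tofrac.
  move=> _ /mapP[g ggs ->]; rewrite -tofracXn -tofracM; apply/IntDF_tofrac.
  by rewrite -!mulrA -exprMn; apply/sgs/map_f.
move=> /IntDF_tofrac/(_ d Dd); rewrite !hornerM !hornerC horner_exp => DscG; apply: nDc.
apply: (localize_num HD HQ (s := s * G.[d] ^+ E)).
- by apply: subringM => //; apply: subringX => //; exact: DG.
- apply: (primeM_notin HQ) => //; first by apply: subringX => //; exact: DG.
  move=> /(primeX HD HQ (DG d Dd)); rewrite horner_prod.
  elim: {+}gs gsD gsQ => [|g r IHr] rD rQ; first by rewrite big_nil => /(prime_notin1 HQ).
  have Drd : D (\prod_(h <- r) (1 - h ^+ N).[d]).
    apply: subring_prod => // h hr; have Dh : IntD D h by apply: rD; rewrite inE hr orbT.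
    by apply: IntDB Dd => //; exact: IntDX.
  have Dg : D g.[d] by apply: rD Dd; exact: mem_head.
  have Qg : Q g.[d] by apply: rQ; exact: mem_head.
  rewrite big_cons; apply: (primeM_notin HQ) => //.
  + by rewrite !hornerE; apply: (subringB HD); [exact: subring1 | exact: subringX].
  + rewrite !hornerE => Q1; apply: (prime_notin1 HQ); rewrite -[1](subrK (g.[d] ^+ N)).
    apply: (idealD Qid) => //; rewrite -(prednK N0) exprS.
    by apply: (idealMr Qid) => //; exact: subringX.
  + by apply: IHr => h hr; [apply: rD | apply: rQ]; rewrite inE hr orbT.
- by apply: (sub_localize HD HQ); rewrite -mulrA [_ ^+ E * c]mulrC.
Qed.

(** A valuation ring of [K(X)] meets [K] in a valuation ring, and so does any larger subring of [K]
    qualify. *)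
Lemma dividing_contract Q (M : {fraction {poly K}} -> Prop) : is_prime R M ->
  is_valuation (localize R M) ->
  (forall z : K, localize R M (tofrac z%:P) -> localize D Q z) -> dividing (localize D Q).
Proof.
move=> HM /(valuation_dividing HR HM frR) vM h z z0.
have tz0 : tofrac z%:P != 0 by rewrite tofrac_eq0 polyC_eq0.
case: (vM _ tz0) => [/h|Mz]; [by left | right; apply: h].
suff -> : tofrac (z^-1)%:P = (tofrac z%:P)^-1 by [].
apply: (mulfI tz0); rewrite (mulfV tz0) -tofracM -polyCM mulfV // -tofrac1.
Qed.

Lemma localize_IntDP (M : {fraction {poly K}} -> Prop) h : is_prime R M -> localize R M h ->
  exists f g, [/\ IntD D f, IntD D g, ~ M (tofrac g) & h * tofrac g = tofrac f].
Proof.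
move=> HM [_ [_ [[f [Df ->]] [g [Dg ->]] nMg ->]]]; exists f, g; split=> //.
by rewrite divfK //; exact: prime_neq0 HM nMg.
Qed.

Lemma polyC_frac_mul (z : K) (f g : {poly K}) : tofrac z%:P * tofrac g = tofrac f ->
  f = z%:P * g.
Proof. by rewrite -tofracM => /eqP; rewrite tofrac_eq => /eqP. Qed.

(** It suffices to find a [t]-maximal [M] whose localization has its constants in [D_Q]. For [Q] in
    [Lambda0] let [M] contain the [g] with [g.[0]] in [Q]; otherwise let it contain the [g] with all
    coefficients in [Q D_Q]. If [z * g = f] with [g] outside [M], compare values at 0, respectively
    a coefficient where [g] is a unit at [Q]. *)
Lemma PvMD_contract : PvMD R -> PvMD D.
Proof.
move=> vR Q tQ; have HQ := tmax_prime HD frD properD tQ; have Qid := prime_ideal HQ.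
apply/(valuation_dividing HD HQ frD).
have [LQ|nLQ] := EM (Lambda0 D Q).
  pose X h := exists2 g, IntD D g /\ Q g.[0] & h = tofrac g.
  have [|[s sX s1]|[M tM XM]] := @tgen_or_tmax _ _ HR frR X.
  - by move=> _ [g [Dg _] ->]; exact/IntDF_tofrac.
  - have [gs sE gsP] := map_tofracP sX; exfalso; rewrite sE in s1.
    by apply: lambda0_eval LQ (subring0 HD) _ _ s1 => g /gsP [].
  - have HM := tmax_prime HR frR properR tM.
    apply: (dividing_contract HM (vR M tM)) => z /(localize_IntDP HM)[f [g [Df Dg nMg]]].
    move=> /polyC_frac_mul fE; apply: (localize_num HD HQ (s := g.[0])).
    + by apply: Dg; exact: subring0.
    + by move=> Qg0; apply: nMg; apply: XM; exists g.
    + apply: (sub_localize HD HQ); have := Df _ (subring0 HD).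
      by rewrite fE hornerM hornerC mulrC.
pose X h := exists2 g : {poly K}, IntD D g /\ forall i, exists s, [/\ D s, ~ Q s & Q (s * g`_i)]
  & h = tofrac g.
have tpQ := tmax_t_prime tQ.
have [|[r rX r1]|[M tM XM]] := @tgen_or_tmax _ _ HR frR X.
- by move=> _ [g [Dg _] ->]; exact/IntDF_tofrac.
- have [gs rE gsP] := map_tofracP rX; exfalso; rewrite rE in r1.
  pose C := flatten (map (@polyseq K) gs).
  have CQ c : c \in C -> exists s, [/\ D s, ~ Q s & Q (s * c)].
    by move=> /flatten_mapP[g /gsP [_ Qg] /(nthP 0)[i _ <-]]; exact: Qg.
  have [s [Ds nQs sC]] : exists s, [/\ D s, ~ Q s & forall c, c \in C -> Q (s * c)].
    elim: (C) CQ => [|c l IHl] lQ.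
      by exists 1; split=> //; [exact: subring1 | exact: prime_notin1 HQ].
    have [x xl|s [Ds nQs sl]] := IHl; first by apply: lQ; rewrite inE xl orbT.
    have [t [Dt nQt tc]] := lQ c (mem_head _ _).
    exists (s * t); split; [exact: subringM | exact: primeM_notin HQ _ _ _ _ | move=> x].
    rewrite inE => /predU1P[->|xl]; first by rewrite -mulrA; exact: idealMl Qid _ _.
    by rewrite mulrAC; apply: idealMr Qid _ _ => //; exact: sl.
  (* [s] is outside the [t]-ideal [Q], hence not in the [v]-closure of the elements [s * c]. The
     constant [y * s] then multiplies every [g] into [D[X]] without lying in [D], against [r1]. *)
  have [y [yC nDy]] : exists y, (forall c, c \in map ( *%R s) C -> D (y * c)) /\ ~ D (y * s).
    apply: contrapT => h; apply: nQs; apply: (t_prime_tclosed tpQ (s := map ( *%R s) C)).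
      by move=> _ /mapP[c cC ->]; exact: sC.
    by move=> y yC; apply: contrapT => nD; apply: h; exists y.
  apply: nDy; apply/(IntDC HD)/IntDF_tofrac; rewrite -[tofrac _]mulr1; apply: r1.
  move=> _ /mapP[g ggs ->]; rewrite -tofracM; apply/IntDF_tofrac/(polyOverP_IntD HD) => i.
  rewrite coefCM; have [ltig|leig] := ltnP i (size g); last first.
    by rewrite nth_default // mulr0; exact: subring0.
  by rewrite -mulrA; apply/yC/map_f/flatten_mapP; exists g => //; exact: mem_nth.
- have HM := tmax_prime HR frR properR tM; have HDQ := localize_subring HD HQ.
  apply: (dividing_contract HM (vR M tM)) => z /(localize_IntDP HM)[f [g [Df Dg nMg]]].
  move=> /polyC_frac_mul fE.
  have [i gi] : exists i, ~ exists s, [/\ D s, ~ Q s & Q (s * g`_i)].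
    by apply: contrapT => /forallNP h; apply/nMg/XM; exists g => //; split=> // i; apply: contrapT; exact: h.
  have := not_lambda0_poly tpQ nLQ Df i; rewrite fE coefCM.
  case: (not_lambda0_poly tpQ nLQ Dg i) (gi) => a [s [Da Ds nQs ->]] h Dza.
  have s0 := prime_neq0 HQ nQs; apply: (localize_num HD HQ (s := a)) => //.
    by move=> Qa; apply: h; exists s; split=> //; rewrite mulrC divfK.
  have -> : a * z = s * (z * (a / s)) by rewrite mulrCA [s * _]mulrC divfK // mulrC.
  by apply: (subringM HDQ) => //; exact: sub_localize.
Qed.

End LambdaZero.

(** * Prime [t]-ideals [P] with [D_0] inside [D_P], and uniform exponents over [Lambda0] *)

Section TPrimesAndDZero.
Variables (K : fieldType) (D : K -> Prop).
Hypothesis HD : is_subring D.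
Hypothesis frD : forall x, inFrac D x.
Hypothesis properD : exists z, ~ D z.
Hypothesis Hloc : forall P : K -> Prop, t_maximal D P ->
  forall g : {poly K}, IntDloc D P g <-> IntD (localize D P) g.

Local Notation R := (IntDF D).
Let HR : is_subring R := IntDF_subring HD.
Let frR : forall h, inFrac R h := IntDF_frac HD frD.
Let properR : exists z, ~ R z := IntDF_proper D.

Implicit Types P Q : K -> Prop.

Lemma lambda0_prime Q : Lambda0 D Q -> is_prime D Q. Proof. by case=> [[]]. Qed.

Lemma sub_D0 x : D x -> D0 D x.
Proof. by move=> Dx Q /lambda0_prime HQ; exact: sub_localize. Qed.

Lemma D0_subring : is_subring (D0 D).
Proof.
split; [exact: sub_D0 (subring0 HD) | exact: sub_D0 (subring1 HD) | |].
- move=> x y Dx Dy Q LQ; have HQ := lambda0_prime LQ.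
  by apply: (subringB (localize_subring HD HQ)); [exact: Dx | exact: Dy].
- move=> x y Dx Dy Q LQ; have HQ := lambda0_prime LQ.
  by apply: (subringM (localize_subring HD HQ)); [exact: Dx | exact: Dy].
Qed.

Lemma IntD_D0 f : (forall Q, Lambda0 D Q -> forall d, D d -> localize D Q f.[d]) -> IntD (D0 D) f.
Proof.
move=> Df x D0x Q LQ; apply: (int_valued_localize HD (lambda0_prime LQ)); last exact: D0x.
exact: Df.
Qed.

Lemma IntD_sub_D0 f : IntD D f -> IntD (D0 D) f.
Proof.
by move=> Df; apply: IntD_D0 => Q LQ d Dd; apply: (sub_localize HD (lambda0_prime LQ)); exact: Df.
Qed.

Lemma IntDF_sub_D0 h : R h -> IntDF (D0 D) h.
Proof. by case=> f [Df ->]; exists f; split=> //; exact: IntD_sub_D0. Qed.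

Lemma t_prime_sub_tmax P : t_prime D P -> exists2 Q, t_maximal D Q & forall x, P x -> Q x.
Proof.
move=> tP; have [Pid P1 _] := tP.1.
have [x|[s sP s1]|//] := @tgen_or_tmax _ _ HD frD P; first exact: ideal_sub Pid.
by case: P1; exact: t_prime_tclosed tP _ _ sP s1.
Qed.

Hypothesis vD : PvMD D.

Lemma tmax_dividing Q : t_maximal D Q -> dividing (localize D Q).
Proof. by move=> tQ; apply/valuation_dividing => //; [exact: tmax_prime tQ | exact: vD]. Qed.

Lemma t_prime_dividing P : t_prime D P -> dividing (localize D P).
Proof.
move=> /t_prime_sub_tmax [Q tQ PQ] x /(tmax_dividing tQ)[Dx|Dx]; [left | right].
  by apply: localize_mono Dx => y _; exact: PQ.
by apply: localize_mono Dx => y _; exact: PQ.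
Qed.

(** At each [t]-maximal ideal [z] or [z^-1] is in the localization, so the [r] with [r * z] or
    [r / z] in [D] contain a list with 1 in its [v]-closure. Replacing [y] by [y / z] where [y * z]
    is not in [D] gives [J]. For [Q] in [Lambda0], [z] is in [D_Q], so [y / z] in [Q] would force
    [y] in [Q]. *)
Lemma D0_conductor z : D0 D z -> exists J : seq K, [/\ allin J D, forall y, y \in J -> D (y * z) &
  forall Q, Lambda0 D Q -> exists2 y, y \in J & ~ Q y].
Proof.
move=> D0z; have [z0|z0] := eqVneq z 0.
  exists [:: 1]; split=> [y|y|Q LQ]; rewrite ?inE.
  - by move=> /eqP->; exact: subring1.
  - by move=> _; rewrite z0 mulr0; exact: subring0.
  - by exists 1; [rewrite mem_head | exact: prime_notin1 (lambda0_prime LQ)].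
have [|[s sX s1]|[Q tQ XQ]] :=
    @tgen_or_tmax _ _ HD frD (fun r => D r /\ (D (r * z) \/ D (r / z))); first by move=> x [].
- exists [seq (if `[< D (y * z) >] then y else y / z) | y <- s]; split.
  + move=> _ /mapP[y /sX [Dy Dyz] ->]; case: asboolP => // nD.
    by case: Dyz.
  + move=> _ /mapP[y /sX [Dy Dyz] ->]; case: asboolP => // nD.
    by rewrite divfK.
  + move=> Q LQ; apply: contrapT => nQ; have HQ := lambda0_prime LQ.
    apply: (tmax_vfin1 HD frD properD (lambda0_tmax HD LQ) _ s1) => y ys.
    have [Dy Dyz] := sX y ys.
    have : Q (if `[< D (y * z) >] then y else y / z).
      by apply: contrapT => nQy; apply: nQ; eexists; [apply: map_f ys | ].
    case: asboolP => // nD Qyz; rewrite -[y](divfK z0).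
    by apply: (prime_contract HQ) => //; [exact: D0z | rewrite divfK].
- have HQ := tmax_prime HD frD properD tQ; exfalso.
  case: (tmax_dividing tQ z0) => /(localize_clear HQ)[s [Ds nQs Dsz]]; apply: nQs.
    by apply: XQ; split=> //; left.
  by apply: XQ; split=> //; right.
Qed.

(** Let [j] have least value at [P] among [p] and [J], and let [s] outside [P] clear the quotients
    by [j]. If no [Q] contained [J], then [s / j] would lie in [D_0], hence in [D_P], and
    [s = j * (s / j)] in [P]. *)
Lemma lambda0_above P p (J : seq K) : t_prime D P -> (forall x, D0 D x -> localize D P x) ->
  P p -> p != 0 -> allin J P -> exists2 Q, Lambda0 D Q & allin J Q.
Proof.
move=> tP D0P Pp p0 JP; apply: contrapT => nQ; have [HP _] := tP.
have HDP := localize_subring HD HP.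
have pJP : allin (p :: J) P by move=> y; rewrite inE => /predU1P[->|/JP].
have [|j [jJ j0 Jj]] := dividing_seq HDP (t_prime_dividing tP) (s := p :: J).
  by exists p; rewrite ?mem_head.
have [y|s [Ds nPs sJ]] := localize_clear_seq HD HP (r := [seq y / j | y <- p :: J]).
  by move=> /mapP[x xJ ->]; exact: Jj.
have D0z : D0 D (s / j).
  move=> Q LQ; have HQ := lambda0_prime LQ.
  have [y yJ nQy] : exists2 y, y \in J & ~ Q y.
    apply: contrapT => h; apply: nQ; exists Q => // y yJ.
    by apply: contrapT => nQy; apply: h; exists y.
  have Dy : D y by apply: ideal_sub (prime_ideal HP) _; exact: JP.
  apply: (localize_num HD HQ Dy nQy); apply: (sub_localize HD HQ).
  rewrite mulrC -mulrA [_^-1 * y]mulrC; apply: sJ; apply/mapP.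
  by exists y; rewrite // inE yJ orbT.
apply: nPs; rewrite -[s](divfK j0) mulrC; apply: (prime_contract HP).
- exact: pJP.
- exact: D0P.
- by rewrite mulrC divfK.
Qed.

Hypothesis vR : PvMD R.

(** By [lambda0_above] and [lambda0_eval], the [g] with [g.[0]] in [P] lie in a [t]-maximal [M],
    whose localization contains [p / X] or [X / p]. With [g] a denominator, the first gives [p *
    g.[0] = 0]; the second gives [g.[0] = p * f_1], where [f_1] is in [D_P] if [P] is not in
    [Lambda0]. Either way [g] is in [M]. *)
Lemma lambda0_closed P p : t_prime D P -> P p -> p != 0 ->
  (forall x, D0 D x -> localize D P x) -> Lambda0 D P.
Proof.
move=> tP Pp p0 D0P; apply: contrapT => nL; have [HP _] := tP.
have Dp : D p := ideal_sub (prime_ideal HP) Pp.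
pose X h := exists2 g, IntD D g /\ P g.[0] & h = tofrac g.
have [|[s sX s1]|[M tM XM]] := @tgen_or_tmax _ _ HR frR X.
- by move=> _ [g [Dg _] ->]; exact/IntDF_tofrac.
- have [gs sE gsP] := map_tofracP sX; rewrite sE in s1.
  have [|Q LQ JQ] := @lambda0_above P p [seq g.[0] | g <- gs] tP D0P Pp p0.
    by move=> _ /mapP[g /gsP [_ Pg] ->].
  apply: (lambda0_eval HD frD properD Hloc LQ (subring0 HD) _ _ s1) => g ggs.
    by case: (gsP g ggs).
  by apply: JQ; exact: (map_f (fun g : {poly K} => g.[0])).
have HM := tmax_prime HR frR properR tM.
have /(valuation_dividing HR HM frR) vM := vR tM.
have X0 : tofrac ('X : {poly K}) != 0 by rewrite tofrac_eq0 polyX_eq0.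
have tp0 : tofrac (p%:P : {poly K}) != 0 by rewrite tofrac_eq0 polyC_eq0.
have q0 := mulf_neq0 tp0 (invr_neq0 X0).
case: (vM _ q0) => [|]; rewrite ?invf_div => /(localize_IntDP HM)[f [g [Df Dg nMg fE]]]; apply: nMg.
- have /eqP : tofrac (p%:P * g) = tofrac ('X * f).
    by rewrite !tofracM -fE mulrA [tofrac 'X * _]mulrC (divfK X0).
  rewrite tofrac_eq => /eqP/(congr1 (fun q : {poly K} => q.[0])).
  rewrite !hornerE => /eqP; rewrite mulf_eq0 (negPf p0) /= => /eqP g0.
  by apply: XM; exists g => //; split=> //; rewrite g0; exact: ideal0 (prime_ideal HP).
- have /eqP : tofrac ('X * g) = tofrac (p%:P * f).
    by rewrite !tofracM -fE mulrA [tofrac p%:P * _]mulrC (divfK tp0).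
  rewrite tofrac_eq => /eqP/(congr1 (fun q : {poly K} => q`_1)).
  rewrite coefXM coefCM /= => g0E.
  have gE : g.[0] = p * f`_1 by rewrite horner_coef0.
  apply: XM; exists g => //; split=> //; rewrite gE.
  apply: (prime_contract HP) => //; first exact: not_lambda0_poly tP nL Df 1%N.
  by rewrite -gE; apply: Dg; exact: subring0.
Qed.

(* If [c ^- l / a] were never in [D_P], the elements of [D] divisible in [D_P] by all powers
   of [c^-1] would form a nonzero [t]-prime strictly below [P]; it would belong to
   [Lambda0] and hence be a maximal ideal. *)
Lemma lambda0_archimedean P a c : Lambda0 D P -> D a -> a != 0 -> ~ localize D P c ->
  exists l, localize D P (c ^- l / a).
Proof.
move=> LP Da a0 nDc; apply: contrapT => /forallNP nl; have [tP _] := LP; have [HP _] := tP.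
have HDP := localize_subring HD HP; have div := t_prime_dividing tP.
have c0 : c != 0 by apply/eqP => c0; apply: nDc; rewrite c0; exact: subring0.
have Dci : localize D P c^-1 by case: (div _ c0).
pose P1 x := D x /\ forall l, localize D P (x * c ^+ l).
have P1id : is_ideal D P1.
  split=> [x [] // | | x y [Dx Px] [Dy Py] | x y Dx [Dy Py]].
  - by split=> [|l]; rewrite ?mul0r; [exact: subring0 | exact: subring0].
  - split=> [|l]; first exact: subringD.
    by rewrite mulrDl; apply: (subringD HDP).
  - split=> [|l]; first exact: subringM.
    by rewrite -mulrA; apply: (subringM HDP) => //; exact: sub_localize.
have P1P x : P1 x -> P x.
  move=> [Dx Px]; apply: contrapT => nPx; apply: nDc.
  by apply: (localize_num HD HP Dx nPx); exact: (Px 1%N).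
have HP1 : is_prime D P1.
  split=> //; first by move=> [_ /(_ 1%N)]; rewrite mul1r.
  move=> x y Dx Dy [_ Pxy]; apply: contrapT => /not_orP[nPx nPy].
  have [l nx] : exists l, ~ localize D P (x * c ^+ l).
    by apply: contrapT => /forallNP h; apply: nPx; split=> // l; apply: contrapT; exact: h.
  have [k ny] : exists k, ~ localize D P (y * c ^+ k).
    by apply: contrapT => /forallNP h; apply: nPy; split=> // k; apply: contrapT; exact: h.
  have yc0 : y * c ^+ k != 0 by apply/eqP => yc0; apply: ny; rewrite yc0; exact: subring0.
  apply: nx; have -> : x * c ^+ l = x * y * c ^+ (l + k) * (y * c ^+ k)^-1.
    by apply: (canRL (mulfK yc0)); rewrite exprD mulrACA.
  by apply: (subringM HDP) => //; case: (div _ yc0).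
have tP1 : t_prime D P1.
  split=> //; apply: tclosed_ideal_t => // T x TP1 Tx.
  have Dx : D x by apply: ideal_sub (vfin_ideal HD _) Tx => y /TP1 [].
  split=> // l; have [y|s [Ds nPs sT]] := localize_clear_seq HD HP (r := [seq t * c ^+ l | t <- T]).
    by move=> /mapP[t /TP1 [_ h] ->]; exact: h.
  apply: (localize_num HD HP Ds nPs); apply: (sub_localize HD HP).
  rewrite mulrCA mulrC; apply: Tx => t tT; rewrite -mulrA [_ * t]mulrC; apply: sT.
  exact: (map_f (fun t => t * c ^+ l)).
have P1a : P1 a.
  split=> // l; have al0 : a * c ^+ l != 0 by rewrite mulf_neq0 ?expf_neq0.
  by case: (div _ al0) => //; rewrite invfM mulrC => /nl.
have [N N0 PN] : exists2 N, (0 < N)%N & forall x, D x -> ~ P1 x -> P1 (x ^+ N - 1).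
  apply: (lambda0_torsion HD); apply: lambda0_closed tP1 P1a a0 _ => x D0x.
  by apply: (@localize_mono _ _ P1 P) => [y _|]; [exact: P1P | exact: D0x].
(* The numerator [x] of [c^-1] lies in [P] but not in [P1], so torsion modulo [P1] puts 1 in [P]. *)
have [x [s [Dx Ds nPs cE]]] := Dci.
have s0 := prime_neq0 HP nPs.
have sE : s = x * c by rewrite -(divfK s0 x) -cE mulrAC mulVf // mul1r.
have Px : P x by apply: contrapT => nPx; apply: nDc; apply: (localize_num HD HP Dx nPx); rewrite -sE; exact: sub_localize.
have nP1x : ~ P1 x.
  move=> [_ /(_ 2%N)]; rewrite expr2 mulrA -sE => Dsc; apply: nDc.
  exact: (localize_num HD HP Ds nPs Dsc).
apply: (prime_notin1 HP); have -> : 1 = x ^+ N - (x ^+ N - 1) by rewrite opprB addrC subrK.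
apply: (idealB HD (prime_ideal HP)); last by apply/P1P/PN.
by rewrite -(prednK N0) exprS; apply: (idealMr (prime_ideal HP)) => //; exact: subringX.
Qed.

(** [X ^+ m.+1 - X] plays the role of [X ^+ q - X] over a field with [q] elements; [s] brings
    [(X ^+ m.+1 - X) ^+ e / a] into [Int(D)]. *)
Definition frobenius_den a s m e := forall x, D x -> D (s * ((x ^+ m.+1 - x) ^+ e / a)).

(** Each [t = x ^+ N.+1 - x] is in [P], and [t ^+ (E * l) / a] is the product of [(c * t ^+ E) ^+ l]
    and [c ^- l / a], both in [D_P]. [IntDloc_clear_seq] provides one [s] for all [x]. *)
Lemma lambda0_frobenius P a : Lambda0 D P -> D a -> a != 0 ->
  exists s m e, [/\ D s, ~ P s, (0 < m)%N & frobenius_den a s m e].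
Proof.
move=> LP Da a0; have HP := lambda0_prime LP; have Pid := prime_ideal HP.
have HDP := localize_subring HD HP.
have [N N0 PN] := lambda0_torsion HD LP; have [f Df nDf] := lambda0_not_poly HD LP.
have [c [E [nDc E0 cE]]] := not_poly_conductor HD HP Df nDf.
have [l Dl] := lambda0_archimedean LP Da a0 nDc.
have c0 : c != 0 by apply/eqP => c0; apply: nDc; rewrite c0; exact: subring0.
pose g : {poly K} := (a^-1)%:P * ('X ^+ N.+1 - 'X) ^+ (E * l).
have gE x : g.[x] = (x ^+ N.+1 - x) ^+ (E * l) / a by rewrite /g !hornerE mulrC.
have [h|s [Ds nPs sg]] := @IntDloc_clear_seq _ _ HD frD properD Hloc P [:: g] (lambda0_tmax HD LP).
  rewrite inE => /eqP-> x Dx; rewrite gE exprM.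
  have Pt : P (x ^+ N.+1 - x).
    have -> : x ^+ N.+1 - x = x * (x ^+ N - 1) by rewrite mulrBr mulr1 exprS.
    have [Px|nPx] := EM (P x); last by apply: (idealMl Pid) => //; exact: PN.
    by apply: (idealMr Pid) => //; apply: subringB => //; [exact: subringX | exact: subring1].
  move: (_ - _) Pt => t Pt.
  have -> : t ^+ E ^+ l / a = (c * t ^+ E) ^+ l * (c ^- l / a).
    by rewrite exprMn mulrA; congr (_ / a); rewrite mulrAC mulfV ?mul1r // expf_neq0.
  by apply: (subringM HDP) => //; apply: (subringX HDP); exact: cE.
exists s, N, (E * l)%N; split=> // x Dx; rewrite -gE.
by have := sg g (mem_head _ _) x Dx; rewrite hornerM hornerC.
Qed.

(** [X ^+ m.+1 - X] divides [X ^+ (m * m').+1 - X]; this allows common exponents for finitely many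
    denominators. *)
Lemma frobenius_den_mul a s m e m' e' : frobenius_den a s m e ->
  frobenius_den a s (m * m') (e + e').
Proof.
move=> h x Dx; pose u := \sum_(i < m') (x ^+ m) ^+ i.
have Du : D u by apply: subring_sum => // i _; apply: subringX => //; exact: subringX.
have E : x ^+ (m * m').+1 - x = (x ^+ m.+1 - x) * u.
  have E0 k : x ^+ k.+1 - x = x * (x ^+ k - 1) by rewrite exprS mulrBr mulr1.
  by rewrite !E0 -mulrA exprM subrX1.
have -> : s * ((x ^+ (m * m').+1 - x) ^+ (e + e') / a) =
   s * ((x ^+ m.+1 - x) ^+ e / a) * (u ^+ e * (x ^+ (m * m').+1 - x) ^+ e').
  by rewrite exprD {1}E exprMn; ring.
apply: subringM => //; first exact: h.
apply: subringM => //; apply: subringX => //; apply: subringB => //; exact: subringX.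
Qed.

(** If finitely many denominators in [S] lie together in no [Q] of [Lambda0], common exponents work
    for all [Q]. Otherwise a maximal closed set [M] containing [S] is a [t]-prime; it contains [a]
    (take [e = 0]), so it belongs to [Lambda0] by [lambda0_closed], and [lambda0_frobenius] gives a
    member of [S] outside it. *)
Lemma uniform_frobenius a : D a -> a != 0 ->
  exists m e, (0 < m)%N /\ forall Q, Lambda0 D Q -> forall x, D x ->
    localize D Q ((x ^+ m.+1 - x) ^+ e / a).
Proof.
move=> Da a0.
pose S s := D s /\ exists m e, (0 < m)%N /\ frobenius_den a s m e.
pose cl (s : seq K) x := D x /\ forall Q, Lambda0 D Q -> allin s Q -> Q x.
have [[s sS [_ s1]]|ncl] := EM (exists2 s, allin s S & cl s 1).
  have [m [e [m0 me]]] : exists m e, (0 < m)%N /\ forall y, y \in s -> frobenius_den a y m e.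
    elim: (s) sS => [|y r IHr] rS; first by exists 1%N, 0%N.
    have [z zr|m [e [m0 me]]] := IHr; first by apply: rS; rewrite inE zr orbT.
    have [_ [m' [e' [m'0 ye]]]] := rS y (mem_head _ _).
    exists (m * m')%N, (e + e')%N; split; first by rewrite muln_gt0 m0.
    move=> z; rewrite inE => /predU1P[->|/me]; last exact: frobenius_den_mul.
    by rewrite mulnC addnC; exact: frobenius_den_mul.
  exists m, e; split=> // Q LQ x Dx; have HQ := lambda0_prime LQ.
  have [y ys nQy] : exists2 y, y \in s & ~ Q y.
    apply: contrapT => h; apply: (prime_notin1 HQ); apply: s1 => // y ys.
    by apply: contrapT => nQy; apply: h; exists y.
  have [Dy _] := sS y ys; apply: (localize_num HD HQ Dy nQy); apply: (sub_localize HD HQ).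
  exact: me.
have SD x : S x -> D x by case.
exfalso; have [|||||M [SM Mcl HM _]] := @exists_max_closed _ D cl _ _ _ _ S SD.
- by move=> s x sD xs; split; [exact: sD | move=> Q _; apply].
- move=> s t x st [Dx sx]; split=> // Q LQ tQ; apply: sx => // y ys.
  by case: (st y ys) => _; apply.
- move=> s sD; split=> [x [] //||x y [Dx sx] [Dy sy]|x y Dx [Dy sy]].
  + by split=> [|Q LQ _]; [exact: subring0 | exact: ideal0 (prime_ideal (lambda0_prime LQ))].
  + split=> [|Q LQ sQ]; first exact: subringD.
    by apply: (idealD (prime_ideal (lambda0_prime LQ))); [exact: sx | exact: sy].
  + split=> [|Q LQ sQ]; first exact: subringM.
    by apply: (idealMl (prime_ideal (lambda0_prime LQ))) => //; exact: sy.
- move=> s b x sD Db [Dx sx]; split=> [|Q LQ sQ]; first exact: subringM.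
  have HQ := lambda0_prime LQ; have Qid := prime_ideal HQ.
  have [Qb|nQb] := EM (Q b); first exact: idealMr Qid _ _.
  apply: (idealMl Qid) => //; apply: sx => // y ys.
  have Qby : Q (b * y) by apply: sQ; exact: map_f.
  by case: HQ => _ _ /(_ b y Db (sD y ys) Qby) [].
- by move=> s sS s1; apply: ncl; exists s.
have tM : t_prime D M.
  split=> //; apply: (tclosed_ideal_t HD (prime_ideal HM)) => s x sM sx.
  have sD : allin s D by move=> y /sM; exact: ideal_sub (prime_ideal HM).
  apply: Mcl sM _; split; first exact: ideal_sub (vfin_ideal HD sD) sx.
  by move=> Q [tQ _] sQ; exact: t_prime_tclosed tQ _ _ sQ sx.
have LM : Lambda0 D M.
  apply: (lambda0_closed tM (p := a)) => //.
    apply: SM; split=> //; exists 1%N, 0%N; split=> // x _.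
    by rewrite expr0 div1r mulfV //; exact: subring1.
  (* [J] is contained in no [Q] of [Lambda0], so 1 is in its closure and some entry of [J] is
     outside [M]. *)
  move=> z /D0_conductor [J [JD Jz JQ]].
  have [y yJ nMy] : exists2 y, y \in J & ~ M y.
    apply: contrapT => h; apply: (prime_notin1 HM); apply: (Mcl J).
      by move=> y yJ; apply: contrapT => nMy; apply: h; exists y.
    by split=> [|Q LQ JsQ]; [exact: subring1 | case: (JQ Q LQ) => y /JsQ].
  apply: (localize_num HD HM _ nMy); first exact: JD.
  by apply: (sub_localize HD HM); exact: Jz.
have [s [m [e [Ds nMs m0 sme]]]] := lambda0_frobenius LM Da a0.
by apply/nMs/SM; split=> //; exists m, e.
Qed.

End TPrimesAndDZero.

(** * [Int(D)] a PvMD implies [Int(D_0)] Pruefer *)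

Lemma span_mono (F : fieldType) (A B : F -> Prop) s x : (forall y, A y -> B y) ->
  span A s x -> span B s x.
Proof. by move=> AB [c [Ac ->]]; exists c; split=> // i; exact: AB. Qed.

(** * Nonzero constants in ideals of [Int(D)] *)

Section PolySpan.
Variable K : fieldType.
Implicit Types (gs : seq {poly K}) (D : K -> Prop).

Definition polys (h : {fraction {poly K}}) := exists g, h = tofrac g.

Lemma polys_subring : is_subring polys.
Proof.
split; [by exists 0; rewrite tofrac0 | by exists 1; rewrite tofrac1 | |].
- by move=> _ _ [g ->] [h ->]; exists (g - h); rewrite tofracB.
- by move=> _ _ [g ->] [h ->]; exists (g * h); rewrite tofracM.
Qed.

Lemma poly_bezout gs : exists2 p, (forall g, g \in gs -> p %| g) &
  span polys (map (@tofrac _) gs) (tofrac p).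
Proof.
have HS := polys_subring.
elim: gs => [|g gs [p pgs ps]]; first by exists 0 => //; rewrite tofrac0; exact: span0.
have [[u v] /= uvE] := Bezoutp g p; exists (u * g + v * p) => [f|].
  rewrite (eqp_dvdl _ uvE) inE => /predU1P[->|/pgs]; first exact: dvdp_gcdl.
  by apply: dvdp_trans; exact: dvdp_gcdr.
rewrite tofracD !tofracM; apply/(span_cons _).
exists (tofrac u), (tofrac v * tofrac p); split=> //; first by exists u.
by apply: (spanM HS) => //; exists v.
Qed.

(** Let [p] be a gcd of [gs] over [K] and let [b] clear the denominators of the quotients by [p].
    Then [b / p] multiplies [gs] into [Int(D)], so it is a polynomial and [p] is constant. Hence 1
    is a combination of [gs] over [K[X]], and clearing its coefficients yields [a]. *)
Lemma vfin1_bezout D gs : is_subring D -> (forall x, inFrac D x) ->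
  vfin (IntDF D) (map (@tofrac _) gs) 1 ->
  exists a, [/\ D a, a != 0 & span (IntDF D) (map (@tofrac _) gs) (tofrac a%:P)].
Proof.
move=> HD frD gs1; have HR := IntDF_subring HD; have [w nRw] := IntDF_proper D.
have [p pgs ps] := poly_bezout gs.
have [p0|p0] := eqVneq p 0.
  case: nRw; rewrite -[w]mulr1; apply: gs1 => _ /mapP[g /pgs + ->].
  by rewrite p0 dvd0p => /eqP->; rewrite tofrac0 mulr0; exact: subring0.
have [b [Db b0 bgs]] := poly_denom_seq HD frD (map (fun g => g %/ p) gs).
have tp0 : tofrac p != 0 by rewrite tofrac_eq0.
have [q [_ qE]] : IntDF D (tofrac b%:P / tofrac p).
  rewrite -[_ / _]mulr1; apply: gs1 => _ /mapP[g ggs ->].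
  have -> : tofrac g = tofrac (g %/ p) * tofrac p by rewrite -tofracM divpK ?pgs.
  rewrite mulrCA (divfK tp0) mulrC -tofracM.
  by apply/IntDF_tofrac/(polyOverP_IntD HD)/bgs; exact: map_f.
have bE : b%:P = q * p.
  by apply/eqP; rewrite -tofrac_eq tofracM -qE (divfK tp0).
have [k k0 pE] : exists2 k, k != 0 & p = k%:P.
  have : size p == 1%N.
    have pb : p %| b%:P by rewrite bE dvdp_mulIr.
    by rewrite -dvdp1; apply: dvdp_trans pb _; rewrite dvdp1 size_polyC b0.
  by case/size_poly1P=> k k0 ->; exists k.
have {}ps : span polys (map (@tofrac _) gs) 1.
  have -> : 1 = tofrac (k^-1)%:P * tofrac p by rewrite pE -tofracM -polyCM mulVf // tofrac1.
  by apply: spanM => //; [exact: polys_subring | eexists].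
suff [a [Da a0]] : exists a, [/\ D a, a != 0 & span (IntDF D) (map (@tofrac _) gs) (tofrac a%:P * 1)].
  by rewrite mulr1; exists a.
apply: (@span_least _ polys (map (@tofrac _) gs)
  (fun h => exists a, [/\ D a, a != 0 & span (IntDF D) (map (@tofrac _) gs) (tofrac a%:P * h)])) ps.
- by exists 1; rewrite mulr0; split; [exact: subring1 | exact: oner_neq0 | exact: span0].
- move=> x y [a [Da a0 ax]] [c [Dc c0 cy]]; exists (a * c); split.
  + exact: subringM.
  + by rewrite mulf_neq0.
  + rewrite polyCM tofracM mulrDr; apply: (spanD HR).
      by rewrite mulrAC mulrC; apply: (spanM HR) => //; apply/IntDF_tofrac/(IntDC HD).
    by rewrite -mulrA; apply: (spanM HR) => //; apply/IntDF_tofrac/(IntDC HD).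
- move=> _ y [g ->] ygs; have [a [Da a0 ag]] := poly_denom_seq HD frD [:: g].
  exists a; split=> //; rewrite mulrA -tofracM; apply: (spanM HR); last exact: span_ext.
  by apply/IntDF_tofrac/(polyOverP_IntD HD)/ag; exact: mem_head.
Qed.

End PolySpan.

(** * Unit ideals of [Int(D_0)] and the Pruefer property *)

Section PruferD0.
Variables (K : fieldType) (D : K -> Prop).
Hypothesis HD : is_subring D.
Hypothesis frD : forall x, inFrac D x.
Hypothesis properD : exists z, ~ D z.
Hypothesis Hloc : forall P : K -> Prop, t_maximal D P ->
  forall g : {poly K}, IntDloc D P g <-> IntD (localize D P) g.
Hypothesis vR : PvMD (IntDF D).

Local Notation R := (IntDF D).
Local Notation R0 := (IntDF (D0 D)).
Let HR : is_subring R := IntDF_subring HD.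
Let HR0 : is_subring R0 := IntDF_subring (D0_subring HD).
Let frR : forall h, inFrac R h := IntDF_frac HD frD.
Let properR : exists z, ~ R z := IntDF_proper D.
Let vD : PvMD D := PvMD_contract HD frD properD Hloc vR.

(* [G = \prod_g (1 - g ^+ m)] is 1 modulo the [g]'s, and at each [Q] in [Lambda0] it is, up
   to a unit, a multiple of some [g ^+ m.+1 - g]: so [G ^+ e] is a multiple of [a]. *)
Lemma vfin1_span_D0 (gs : seq {poly K}) : (forall g, g \in gs -> IntD D g) ->
  vfin R (map (@tofrac _) gs) 1 -> span R0 (map (@tofrac _) gs) 1.
Proof.
move=> gsD gs1; have [a [Da a0 sa]] := vfin1_bezout HD frD gs1.
have [m [e [m0 me]]] := uniform_frobenius HD frD properD Hloc vD vR Da a0.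
pose S := map (@tofrac _) gs; pose G : {poly K} := \prod_(g <- gs) (1 - g ^+ m).
have {}sa : span R0 S (tofrac a%:P) by apply: span_mono sa => h; exact: IntDF_sub_D0.
have D1 : IntD D 1 by move=> x _; rewrite hornerC; exact: subring1.
have Dm g : g \in gs -> IntD D (1 - g ^+ m) by move=> /gsD Dg; apply: IntDB => //; exact: IntDX.
have DG : IntD D G by exact: IntD_prod.
have DGe : R0 (tofrac ((a^-1)%:P * G ^+ e)).
  apply/IntDF_tofrac; apply: (IntD_D0 HD) => Q LQ d Dd; have HQ := lambda0_prime LQ.
  (* By [lambda0_eval] the values at [d] are not all in [Q]; a power of one outside [Q] is the unit
     that is cleared below. *)
  have [g ggs nQg] : exists2 g, g \in gs & ~ Q g.[d].
    apply: contrapT => h; apply: (lambda0_eval HD frD properD Hloc LQ Dd gsD _ gs1) => g ggs.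
    by apply: contrapT => nQg; apply: h; exists g.
  have Dgd : D g.[d] by exact: gsD.
  pose r : {poly K} := \prod_(h <- rem g gs) (1 - h ^+ m).
  have Dr : D r.[d] by apply: IntD_prod Dd => // h /mem_rem; exact: Dm.
  apply: (localize_num HD HQ (s := g.[d] ^+ e)).
  - exact: subringX.
  - by move/(primeX HD HQ Dgd).
  - have -> : g.[d] ^+ e * ((a^-1)%:P * G ^+ e).[d] =
        (- r.[d]) ^+ e * ((g.[d] ^+ m.+1 - g.[d]) ^+ e / a).
      have GE : G.[d] = (1 - g.[d] ^+ m) * r.[d].
        by rewrite /G (big_rem g) //= hornerM hornerD hornerN horner_exp hornerC.
      rewrite hornerM hornerC horner_exp GE; move: (g.[d]) (r.[d]) => x y.
      rewrite mulrCA -exprMn [RHS]mulrA -exprMn mulrC; congr (_ ^+ e / a).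
      by rewrite exprS; ring.
    apply: (subringM (localize_subring HD HQ)); last exact: me.
    by apply: (sub_localize HD HQ); apply: subringX => //; exact: subringN.
have sGe : span R0 S (tofrac (G ^+ e)).
  have -> : G ^+ e = ((a^-1)%:P * G ^+ e) * a%:P by rewrite mulrAC -polyCM mulVf // mul1r.
  by rewrite tofracM; exact: spanM.
have s1G : span R0 S (tofrac (1 - G)).
  rewrite /G /S; elim: (gs) gsD => [|g r IHr] rD.
    by rewrite big_nil subrr tofrac0; exact: span0.
  have rD' h : h \in r -> IntD D h by move=> hr; apply: rD; rewrite inE hr orbT.
  apply/(span_cons _); rewrite big_cons.
  exists (tofrac (g ^+ m.-1 * \prod_(j <- r) (1 - j ^+ m))), (tofrac (1 - \prod_(j <- r) (1 - j ^+ m))).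
  split; [|exact: IHr rD'|].
    apply/IntDF_sub_D0/IntDF_tofrac => //; apply: IntDM => //.
      by apply: IntDX => //; apply: rD; exact: mem_head.
    by apply: IntD_prod => // h /rD' Dh; apply: IntDB => //; exact: IntDX.
  rewrite -tofracM -tofracD; congr tofrac.
  by rewrite -{1}(prednK m0) exprS; ring.
have -> : 1 = tofrac (1 - G) * tofrac (\sum_(i < e) G ^+ i) + tofrac (G ^+ e).
  by rewrite -tofracM -tofracD -opprB mulNr -subrX1 opprB subrK tofrac1.
apply: (spanD HR0) => //; rewrite mulrC; apply: (spanM HR0) => //.
apply/(IntDF_sub_D0 HD)/IntDF_tofrac => x Dx; rewrite horner_sum.
by apply: (subring_sum HD) => i _; exact: IntDX.
Qed.

(** As [Int(D)] is a PvMD, the [r] with [r * h] or [r / h] in [Int(D)] lie in no [t]-maximal ideal.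
    Finitely many of them then generate the unit ideal of [Int(D_0)], so one is outside [N]. *)
Lemma Prufer_D0 : Prufer R0.
Proof.
move=> N [Nid N1 _] h _ h0.
have [|[s sX s1]|[M tM XM]] :=
    @tgen_or_tmax _ _ HR frR (fun r => R r /\ (R (r * h) \/ R (r / h))); first by move=> r [].
  have sR : allin s (fun y => exists2 g, IntD D g & y = tofrac g).
    by move=> y /sX [[g [Dg ->]] _]; exists g.
  have [gs sE gsD] := map_tofracP sR; rewrite sE in s1.
  have := vfin1_span_D0 gsD s1; rewrite -sE => span1.
  have [r rs nNr] : exists2 r, r \in s & ~ N r.
    apply: contrapT => nr; apply: N1; apply: (span_sub_ideal Nid _ span1) => r rs.
    by apply: contrapT => nNr; apply: nr; exists r.
  have r0 : r != 0 by apply/eqP => r0; apply: nNr; rewrite r0; exact: ideal0 Nid.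
  have [Rr [Rrh|Rrh]] := sX r rs; [left | right].
    exists (r * h), r; split=> //; [exact: IntDF_sub_D0 | exact: IntDF_sub_D0 |].
    by rewrite mulrC (mulKf r0).
  exists (r / h), r; split=> //; [exact: IntDF_sub_D0 | exact: IntDF_sub_D0 |].
  by rewrite mulrC (mulKf r0).
have HM := tmax_prime HR frR properR tM; exfalso.
have /(valuation_dividing HR HM frR) vM := vR tM.
case: (vM h h0) => /(localize_clear HM)[r [Rr nMr Rrh]]; apply: nMr; apply: XM; split=> //.
  by left.
by right.
Qed.

End PruferD0.

(** * The converse *)

Section MaxLocal.
Variables (F : fieldType) (A P : F -> Prop).
Hypothesis HA : is_subring A.
Hypothesis HP : is_prime A P.
Let Pid := prime_ideal HP.

(** The maximal ideal [P A_P] of the localization. *)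
Definition maxloc x := exists s, [/\ A s, ~ P s & P (s * x)].

Lemma maxloc_prime : is_prime (localize A P) maxloc.
Proof.
have sub x : maxloc x -> localize A P x.
  move=> [s [As nPs Psx]]; apply: (localize_num HA HP As nPs); apply: (sub_localize HA HP).
  exact: ideal_sub Pid Psx.
split; [split=> // | |].
- by exists 1; rewrite mulr0; split; [exact: subring1 | exact: prime_notin1 HP | exact: ideal0 Pid].
- move=> x y [s [As nPs Psx]] [t [At nPt Pty]]; exists (s * t); split.
  + exact: subringM.
  + exact: primeM_notin HP As At nPs nPt.
  + rewrite mulrDr; apply: (idealD Pid); last by rewrite -mulrA; exact: idealMl Pid As Pty.
    by rewrite mulrAC; exact: idealMr Pid At Psx.
- move=> a x /(localize_clear HP) [t [At nPt Ata]] [s [As nPs Psx]]; exists (t * s); split.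
  + exact: subringM.
  + exact: primeM_notin HP At As nPt nPs.
  + by rewrite mulrACA; exact: idealMl Pid Ata Psx.
- by move=> [s [_ nPs]]; rewrite mulr1.
- move=> x y /(localize_clear HP) [t [At nPt Atx]] /(localize_clear HP) [u [Au nPu Auy]].
  move=> [s [As nPs Psxy]]; have : P (s * ((t * x) * (u * y))).
    have -> : s * ((t * x) * (u * y)) = (t * u) * (s * (x * y)) by ring.
    by apply: (idealMl Pid) => //; exact: subringM.
  case: (HP) => _ _ PM /(PM _ _ As (subringM HA Atx Auy)) [//|/(PM _ _ Atx Auy) []].
    by left; exists t.
  by right; exists u.
Qed.

Lemma maxloc_inv x : localize A P x -> ~ maxloc x -> localize A P x^-1.
Proof.
move=> [a [s [Aa As nPs ->]]] nm; rewrite invf_div; exists s, a; split=> // Pa.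
by apply: nm; exists s; split=> //; rewrite mulrC divfK //; exact: prime_neq0 HP nPs.
Qed.

Lemma maxloc_notin a : A a -> ~ P a -> ~ maxloc a.
Proof. by move=> Aa nPa [s [As nPs]]; exact: primeM_notin HP As Aa nPs nPa. Qed.

(* A local overring of a Pruefer domain contains its localization at a maximal ideal. *)
Lemma overring_Prufer (B : F -> Prop) : is_subring B -> (forall x, inFrac B x) ->
  Prufer B -> (forall x, B x -> localize A P x) -> dividing (localize A P).
Proof.
move=> HB frB pB BA; have mP := maxloc_prime; have mid := prime_ideal mP.
(* The maximal ideal of the localization contracts to a proper ideal of [B]; elements of [B] outside
   a maximal [N] above it are units of the localization. *)
have [||N Nmax mN] := @exists_maximal _ B HB (fun x => B x /\ maxloc x).
- split=> [x [] //||x y [Bx mx] [By my]|a x Ba [Bx mx]].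
  + by split; [exact: subring0 | exact: ideal0 mid].
  + by split; [exact: subringD | exact: idealD mid mx my].
  + by split; [exact: subringM | apply: (idealMl mid) => //; exact: BA].
- by case=> _; exact: prime_notin1 mP.
have toA h : localize B N h -> localize A P h.
  move=> [a [b [Ba Bb nNb ->]]]; apply: (subringM (localize_subring HA HP)); first exact: BA.
  by apply: maxloc_inv; [exact: BA | move=> mb; apply: nNb; exact: mN].
have [_ N1 _] := Nmax.
have BN b : B b -> localize B N b.
  by move=> Bb; exists b, 1; split=> //; [exact: subring1 | rewrite divr1].
move=> h h0; case: (pB N Nmax h _ h0) => [|/toA|/toA]; [|by left|by right].
by have [a [b [Ba Bb b0 ->]]] := frB h; exists a, b; split=> //; exact: BN.
Qed.

End MaxLocal.

(** Gauss's lemma: in the product of the first coefficients outside [m], all other terms of that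
    degree lie in [m]. *)
Lemma prime_poly_mul (F : fieldType) (B m : F -> Prop) (f g : {poly F}) : is_subring B ->
  is_prime B m -> polyOverP B f -> polyOverP B g ->
  (exists i, ~ m f`_i) -> (exists j, ~ m g`_j) -> exists l, ~ m (f * g)`_l.
Proof.
move=> HB mP Bf Bg exf exg; have mid := prime_ideal mP.
have first (h : {poly F}) : (exists i, ~ m h`_i) ->
    exists i, ~ m h`_i /\ forall k, (k < i)%N -> m h`_k.
  move=> exh; have exb : exists i, ~~ `[< m h`_i >] by case: exh => i hi; exists i; exact/asboolPn.
  exists (ex_minn exb); case: ex_minnP => i /asboolPn hi mini; split=> // k ltki.
  by apply: contrapT => /asboolPn /mini; rewrite leqNgt ltki.
have [i [nmi mi]] := first f exf; have [j [nmj mj]] := first g exg.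
exists (i + j)%N => mfg; apply: (primeM_notin mP (Bf i) (Bg j) nmi nmj).
have ltij : (i < (i + j).+1)%N by rewrite ltnS leq_addr.
move: mfg; rewrite coefM (bigD1 (Ordinal ltij)) //= addKn => mfg.
rewrite -[_ * _](addrK (\sum_(k < (i + j).+1 | k != Ordinal ltij) f`_k * g`_(i + j - k))).
apply: (idealB HB mid) => //; apply: big_ind => [|x y|k neki].
- exact: ideal0 mid.
- exact: idealD mid.
- have [ltki|] := ltnP k i; first by apply: (idealMr mid) => //; exact: mi.
  rewrite leq_eqVlt => /orP[/eqP ik|ltik].
    by case/eqP: neki; apply: val_inj; exact: esym ik.
  apply: (idealMl mid) => //; apply: mj.
  by have := ltn_ord k; rewrite ltnS => lek; rewrite ltn_subLR // ltn_add2r.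
Qed.

Lemma coprime_frac (K : fieldType) (h : {fraction {poly K}}) :
  exists a b, [/\ b != 0, coprimep a b & h = tofrac a / tofrac b].
Proof.
have [a [b [b0 ->]]] := fracP h; have g0 : gcdp a b != 0 by rewrite gcdp_eq0 negb_and b0 orbT.
exists (a %/ gcdp a b), (b %/ gcdp a b); split.
- by rewrite dvdp_div_eq0 ?dvdp_gcdr.
- by apply: coprimep_div_gcd; rewrite b0 orbT.
- have tg0 : tofrac (gcdp a b) != 0 by rewrite tofrac_eq0.
  have aE : tofrac a = tofrac (a %/ gcdp a b) * tofrac (gcdp a b).
    by rewrite -tofracM divpK ?dvdp_gcdl.
  have bE : tofrac b = tofrac (b %/ gcdp a b) * tofrac (gcdp a b).
    by rewrite -tofracM divpK ?dvdp_gcdr.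
  by rewrite {1}aE {1}bE -mulf_div (divff tg0) mulr1.
Qed.

(** Write [h] in lowest terms: if numerator and denominator were both in [N], Bezout would put 1
    there. This settles the case [D = K]. *)
Lemma polys_valuation (K : fieldType) (A N : {fraction {poly K}} -> Prop) :
  (forall g, A (tofrac g)) -> is_ideal A N -> ~ N 1 -> is_valuation (localize A N).
Proof.
move=> Ap Nid N1 h _ _; have [a [b [b0 cab ->]]] := coprime_frac h.
have [Nb|nNb] := EM (N (tofrac b)); last by left; exists (tofrac a), (tofrac b).
right; rewrite invf_div; exists (tofrac b), (tofrac a); split=> // Na; apply: N1.
have /Bezout_eq1_coprimepP[[u v] /= uv] := cab.
by rewrite -tofrac1 -uv tofracD !tofracM; apply: (idealD Nid); apply: (idealMl Nid).
Qed.

(** * Localizations of [Int(D)] at a [t]-maximal ideal [M] *)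

Section Conversely.
Variables (K : fieldType) (D : K -> Prop).
Hypothesis HD : is_subring D.
Hypothesis frD : forall x, inFrac D x.
Hypothesis properD : exists z, ~ D z.
Hypothesis Hloc : forall P : K -> Prop, t_maximal D P ->
  forall g : {poly K}, IntDloc D P g <-> IntD (localize D P) g.

Local Notation R := (IntDF D).
Local Notation R0 := (IntDF (D0 D)).
Let HR : is_subring R := IntDF_subring HD.
Let frR : forall h, inFrac R h := IntDF_frac HD frD.
Let properR : exists z, ~ R z := IntDF_proper D.

Lemma localize_tmax_all x : (forall Q, t_maximal D Q -> localize D Q x) -> D x.
Proof.
move=> Lx; have [|[s sX s1]|[Q tQ XQ]] := @tgen_or_tmax _ _ HD frD (fun r => D r /\ D (r * x)).
- by move=> r [].
- by rewrite -[x]mulr1; apply: s1 => y /sX [_]; rewrite mulrC.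
- have [s [Ds nQs Dsx]] := localize_clear (tmax_prime HD frD properD tQ) (Lx Q tQ).
  by case: nQs; exact: XQ.
Qed.

Variable M : {fraction {poly K}} -> Prop.
Hypothesis tM : t_maximal R M.
Let HM : is_prime R M := tmax_prime HR frR properR tM.
Let Mid := prime_ideal HM.

Definition contraction x := D x /\ M (tofrac x%:P).
Local Notation P := contraction.

Lemma frac_poly (J : seq K) h : (exists2 y, y \in J & y != 0) ->
  (forall y, y \in J -> R (h * tofrac y%:P)) -> exists f, h = tofrac f.
Proof.
move=> [y yJ y0] /(_ y yJ) [g [_ gE]]; exists (g * (y^-1)%:P).
have ty0 : tofrac (y%:P : {poly K}) != 0 by rewrite tofrac_eq0 polyC_eq0.
by apply: (mulIf ty0); rewrite gE -tofracM -mulrA -polyCM mulVf // mulr1.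
Qed.

(** If [h] multiplies the constants from [s], not all zero, into [Int(D)], it is a polynomial whose
    values on [D] multiply [s] into [D]. These values then multiply [x] into [D], so [x] is in the
    [v]-closure of [s] in [Int(D)]. *)
Lemma contraction_t_prime : t_prime D P.
Proof.
have Pid : is_ideal D P.
  split=> [x [] //||x y [Dx Mx] [Dy My]|x y Dx [Dy My]].
  - by split; [exact: subring0 | rewrite polyC0 tofrac0; exact: ideal0 Mid].
  - by split; [exact: subringD | rewrite polyCD tofracD; exact: idealD Mid Mx My].
  - split; first exact: subringM.
    by rewrite polyCM tofracM; apply: (idealMl Mid) => //; apply/IntDF_tofrac/(IntDC HD).
have HP : is_prime D P.
  split=> // [[_]|x y Dx Dy [_]]; first by rewrite polyC1 tofrac1; exact: prime_notin1 HM.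
  have Rx z : D z -> R (tofrac z%:P) by move=> Dz; apply/IntDF_tofrac/(IntDC HD).
  rewrite polyCM tofracM; case: (HM) => _ _ MM /(MM _ _ (Rx _ Dx) (Rx _ Dy)) [Mx|My].
    by left.
  by right.
split=> //; apply: (tclosed_ideal_t HD Pid) => s x sP sx.
have sD : allin s D by move=> y /sP [].
have Dx : D x := ideal_sub (vfin_ideal HD sD) sx.
have [s0|s0] := EM (exists2 y, y \in s & y != 0); last first.
  have -> : x = 0; last exact: ideal0 Pid.
  apply/eqP; apply: contrapT => /negP x0; have [z nDz] := properD; apply: nDz.
  rewrite -[z](divfK x0); apply: sx => y ys; have -> : y = 0.
    by apply/eqP; apply: contrapT => /negP y0; apply: s0; exists y.
  by rewrite mulr0; exact: subring0.
split=> //; apply: (tmax_closed HR frR properR tM (s := [seq tofrac y%:P | y <- s])).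
  by move=> _ /mapP[y /sP [_ My] ->].
move=> h hs; have {}hs y : y \in s -> R (h * tofrac y%:P).
  by move=> ys; apply: hs; exact: (map_f (fun y : K => tofrac y%:P)).
have [f fE] := frac_poly s0 hs; subst h.
rewrite -tofracM; apply/IntDF_tofrac => d Dd; rewrite hornerM hornerC; apply: sx => y ys.
by have := hs y ys; rewrite -tofracM => /IntDF_tofrac/(_ d Dd); rewrite hornerM hornerC.
Qed.

Let tP := contraction_t_prime.
Let HP : is_prime D P := tP.1.

Lemma localize_contraction s f : D s -> ~ P s -> IntD D (s%:P * f) -> localize R M (tofrac f).
Proof.
move=> Ds nPs Dsf; apply: (localize_num HR HM (s := tofrac s%:P)).
- exact/IntDF_tofrac/(IntDC HD).
- by move=> Ms; apply: nPs.
- by apply: (sub_localize HR HM); rewrite -tofracM; exact/IntDF_tofrac.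
Qed.

(** For [P] [t]-maximal this is [Hloc]. Otherwise take [p] outside [P] in a [t]-maximal [Q] above
    [P]: since [p ^+ N - 1] is never in [Q], the residue torsion fails and [f] has coefficients in
    [D_P]. *)
Lemma IntD_contraction f : IntD (localize D P) f -> localize R M (tofrac f).
Proof.
move=> Df; have [tmP|ntP] := EM (t_maximal D P).
  have [g|s [Ds nPs sf]] := IntDloc_clear_seq HD frD properD Hloc tmP (gs := [:: f]).
    by rewrite inE => /eqP-> d Dd; apply: Df; exact: sub_localize.
  by apply: (localize_contraction Ds nPs); apply: sf; exact: mem_head.
have [Q tQ PQ] := t_prime_sub_tmax HD frD properD tP.
have [p [Qp nPp]] : exists p, Q p /\ ~ P p.
  apply: contrapT => /forallNP h; apply: ntP; suff -> : P = Q by [].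
  apply/funext => x; apply/propext; split=> [/PQ //|Qx].
  by apply: contrapT => nPx; apply: (h x).
have HQ := tmax_prime HD frD properD tQ.
have Lf : polyOverP (localize D P) f.
  apply: contrapT => /(not_poly_residue_torsion HD HP Df) [N N0 PN].
  have Dp := ideal_sub (prime_ideal HQ) Qp.
  apply: (prime_notin1 HQ); have -> : 1 = p ^+ N - (p ^+ N - 1) by rewrite opprB addrC subrK.
  apply: (idealB HD (prime_ideal HQ)); last by apply/PQ/PN.
  by rewrite -(prednK N0) exprS; apply: (idealMr (prime_ideal HQ)) => //; exact: subringX.
have [g|s [Ds nPs sf]] := poly_clear_seq HD (r := [:: f]) HP; first by rewrite inE => /eqP->.
apply: (localize_contraction Ds nPs); apply: (polyOverP_IntD HD); apply: sf; exact: mem_head.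
Qed.

Hypothesis vD : PvMD D.

(** Divide [f] by a coefficient [c] of least value. By Gauss's lemma [k * (f / c)] has a unit
    coefficient at [Q], so [c] is a coefficient of [k * f] divided by a unit. *)
Lemma gauss_dividing Q (k f : {poly K}) : is_prime D Q -> dividing (localize D Q) ->
  polyOverP D k -> (exists j, ~ Q k`_j) -> polyOverP (localize D Q) (k * f) ->
  polyOverP (localize D Q) f.
Proof.
move=> HQ div Dk [j nQj] Dkf; have HDQ := localize_subring HD HQ.
have [f0|f0] := EM (exists2 y, y \in (f : seq K) & y != 0); last first.
  move=> i; have [ltif|leif] := ltnP i (size f); last by rewrite nth_default //; exact: subring0 HDQ.
  have -> : f`_i = 0; last exact: subring0 HDQ.
  by apply/eqP; apply: contrapT => /negP fi; apply: f0; exists f`_i => //; exact: mem_nth.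
have [c [cf c0 fc]] := dividing_seq HDQ div f0.
have coef_c i : localize D Q (f`_i / c).
  have [ltif|leif] := ltnP i (size f); first by apply: fc; exact: mem_nth.
  by rewrite nth_default // mul0r; exact: subring0 HDQ.
have [l nml] : exists l, ~ maxloc D Q (k * ((c^-1)%:P * f))`_l.
  apply: (prime_poly_mul HDQ (maxloc_prime HD HQ)).
  - by move=> i; exact: sub_localize.
  - by move=> i; rewrite coefCM mulrC.
  - by exists j; apply: maxloc_notin.
  - have /(nthP 0)[i ltif ci] := cf; exists i; rewrite coefCM ci mulVf //.
    exact: prime_notin1 (maxloc_prime HD HQ).
have Dl : localize D Q (k * ((c^-1)%:P * f))`_l.
  apply: polyOverP_M => // [i|i]; first exact: sub_localize.
  by rewrite coefCM mulrC.
have Dc : localize D Q c.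
  have nl0 := prime_neq0 (maxloc_prime HD HQ) nml.
  have -> : c = (k * f)`_l * ((k * ((c^-1)%:P * f))`_l)^-1.
    apply: (canRL (mulfK nl0)).
    by rewrite mulrCA coefCM mulrA mulfV // mul1r.
  by apply: (subringM HDQ) => //; exact: maxloc_inv.
by move=> i; rewrite -[f`_i](divfK c0); exact: (subringM HDQ).
Qed.

(* The finitely many elements [b], [y] in [J] and [u * g], with [u] in the inverse of the
   content ideal of [g], would all lie in [M]; but no [t]-maximal [Q] obstructs: at [Q] in
   [Lambda0] some [y] is a unit, at the others some [u * g] has unit content. *)
Lemma unit_content_notin b (J : seq K) (g : {poly K}) i :
  P b -> b != 0 -> allin J P -> (forall Q, Lambda0 D Q -> exists2 y, y \in J & ~ Q y) ->
  polyOverP D g -> ~ P g`_i -> ~ M (tofrac g).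
Proof.
move=> Pb b0 JP JQ Dg nPi Mg.
pose U u := forall j, D (u * g`_j).
have DU u : U u -> polyOverP D (u%:P * g) by move=> Uu j; rewrite coefCM; exact: Uu.
(* The coefficient of [g] at [i] is outside [P], and multiplying it with [u * g] gives a multiple of
   [g] by an element of [D]; [M] is prime. *)
have MU u : U u -> M (tofrac (u%:P * g)).
  move=> Uu; have Rug : R (tofrac (u%:P * g)) by apply/IntDF_tofrac/(polyOverP_IntD HD)/DU.
  have Rgi : R (tofrac (g`_i)%:P) by apply/IntDF_tofrac/(IntDC HD)/Dg.
  have : M (tofrac (g`_i)%:P * tofrac (u%:P * g)).
    rewrite -tofracM mulrA -polyCM tofracM; apply: (idealMl Mid) => //.
    by apply/IntDF_tofrac/(IntDC HD); rewrite mulrC; exact: Uu.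
  case: (HM) => _ _ MM /(MM _ _ Rgi Rug) [Mgi|//]; case: nPi; split=> //; exact: Dg.
have [|[s sX s1]|[Q tQ XQ]] :=
    @tgen_or_tmax _ _ HD frD (fun r => exists u j, U u /\ r = u * g`_j).
- by move=> _ [u [j [Uu ->]]]; exact: Uu.
- have [us usU sus] : exists2 us, allin us U &
      forall r, r \in s -> exists2 u, u \in us & exists j, r = u * g`_j.
    elim: (s) sX => [|r t IHt] tX; first by exists [::].
    have [y yt|us usU tus] := IHt; first by apply: tX; rewrite inE yt orbT.
    have [u [j [Uu rE]]] := tX r (mem_head _ _); exists (u :: us) => y.
      by rewrite inE => /predU1P[->|/usU].
    rewrite inE => /predU1P[->|/tus [v vus [k ->]]].
      by exists u; [exact: mem_head | exists j].
    by exists v; [rewrite inE vus orbT | exists k].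
  pose T := [seq tofrac y%:P | y <- b :: J] ++ [seq tofrac (u%:P * g) | u <- us].
  have TM : allin T M.
    apply: allin_cat => [_ /mapP[y yJ ->]|_ /mapP[u /usU Uu ->]]; last exact: MU.
    by move: yJ; rewrite inE => /predU1P[->|/JP []] //; case: Pb.
  apply: (tmax_vfin1 HR frR properR tM TM) => h hT.
  have hJ y : y \in b :: J -> R (h * tofrac y%:P).
    by move=> yJ; apply: hT; rewrite mem_cat (map_f (fun y : K => tofrac y%:P)).
  have hus u : u \in us -> R (h * tofrac (u%:P * g)).
    by move=> uu; apply: hT; rewrite mem_cat (map_f (fun u : K => tofrac (u%:P * g))) ?orbT.
  have [|f fE] := @frac_poly (b :: J) h _ hJ; first by exists b; rewrite ?mem_head.
  subst h; rewrite mulr1; apply/IntDF_tofrac => d Dd; apply: localize_tmax_all => Q tQ.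
  have HQ := tmax_prime HD frD properD tQ.
  have [LQ|nLQ] := EM (Lambda0 D Q).
    have [y yJ nQy] := JQ Q LQ; have [Dy _] := JP y yJ.
    apply: (localize_num HD HQ Dy nQy); apply: (sub_localize HD HQ).
    have := hJ y; rewrite inE yJ orbT -tofracM => /(_ isT)/IntDF_tofrac/(_ d Dd).
    by rewrite hornerM hornerC mulrC.
  have [r rs nQr] : exists2 r, r \in s & ~ Q r.
    apply: contrapT => h; apply: (tmax_vfin1 HD frD properD tQ _ s1) => r rs.
    by apply: contrapT => nQr; apply: h; exists r.
  have [u uus [j rE]] := sus r rs.
  suff Lf : polyOverP (localize D Q) f.
    apply: (polyOverP_horner (localize_subring HD HQ) Lf); exact: sub_localize.
  apply: (gauss_dividing HQ (tmax_dividing HD frD properD vD tQ) (DU u (usU u uus))).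
    by exists j; rewrite coefCM -rE.
  apply: (not_lambda0_poly HD (tmax_t_prime HD frD properD tQ) nLQ); apply/IntDF_tofrac.
  by rewrite tofracM mulrC; exact: hus.
(* The content of [g] is invertible at [Q]: with [c] a coefficient of least value and [s] a common
   denominator, [s / c] is in the inverse of the content and [s = (s / c) * c] is outside [Q]. *)
- have HQ := tmax_prime HD frD properD tQ; have HDQ := localize_subring HD HQ.
  have gi0 : g`_i != 0 := prime_neq0 HP nPi.
  have ig : (i < size g)%N by rewrite ltnNge; apply: contra gi0 => /(nth_default 0)->.
  have [|c [cg c0 gc]] := dividing_seq HDQ (tmax_dividing HD frD properD vD tQ) (s := g : seq K).
    by exists g`_i => //; exact: mem_nth.
  have [y|s [Ds nQs sg]] := localize_clear_seq HD HQ (r := [seq y / c | y <- (g : seq K)]).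
    by move=> /mapP[x xg ->]; exact: gc.
  apply: nQs; have /(nthP 0)[j ltjg jc] := cg.
  apply: XQ; exists (s / c), j; split; last by rewrite jc divfK.
  move=> k; have [ltkg|legk] := ltnP k (size g); last first.
    by rewrite nth_default // mulr0; exact: subring0.
  by rewrite mulrAC -mulrA; apply/sg/map_f/mem_nth.
Qed.

(** The list conducting [x] into [D] lies in [P], so [unit_content_notin] applies. Divide numerator
    and denominator of [h] by a coefficient [c] of least value among both; the one containing [c]
    then has unit content and is outside [M]. *)
Lemma outside_D0_dividing x : D0 D x -> ~ localize D P x -> dividing (localize R M).
Proof.
move=> D0x nPx; have [J [JD Jx JQ]] := D0_conductor HD frD properD vD D0x.
have JP : allin J P.
  move=> y yJ; apply: contrapT => nPy; apply: nPx; apply: (localize_num HD HP (JD y yJ) nPy).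
  by apply: (sub_localize HD HP); exact: Jx.
have [a [b [Da Db b0 xE]]] := frD x.
have Pb : P b by apply: contrapT => nPb; apply: nPx; exists a, b.
have notinM := unit_content_notin Pb b0 JP JQ.
move=> h h0; have [p [q [q0 hE]]] := fracP h.
have HDP := localize_subring HD HP; have div := t_prime_dividing HD frD properD vD tP.
have [|c [cpq c0 pqc]] := dividing_seq HDP div (s := (p : seq K) ++ (q : seq K)).
  have lq0 : lead_coef q != 0 by rewrite lead_coef_eq0.
  exists (lead_coef q) => //; rewrite mem_cat lead_coefE mem_nth ?orbT //.
  by rewrite prednK // lt0n size_poly_eq0.
have [y|s [Ds nPs spq]] := localize_clear_seq HD HP (r := [seq y / c | y <- (p : seq K) ++ (q : seq K)]).
  by move=> /mapP[z zpq ->]; exact: pqc.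
have s0 := prime_neq0 HP nPs; have e0 : s / c != 0 by rewrite mulf_neq0 ?invr_eq0.
have De (f : {poly K}) : {subset (f : seq K) <= (p : seq K) ++ (q : seq K)} -> polyOverP D ((s / c)%:P * f).
  move=> fpq k; rewrite coefCM; have [ltkf|lefk] := ltnP k (size f); last first.
    by rewrite nth_default // mulr0; exact: subring0.
  by rewrite mulrAC -mulrA; apply/spq/map_f/fpq/mem_nth.
have Dp := De p; have Dq := De q.
have {}Dp : polyOverP D ((s / c)%:P * p) by apply: Dp => y yp; rewrite mem_cat yp.
have {}Dq : polyOverP D ((s / c)%:P * q) by apply: Dq => y yq; rewrite mem_cat yq orbT.
have te0 : tofrac ((s / c)%:P : {poly K}) != 0 by rewrite tofrac_eq0 polyC_eq0.
have Rp := polyOverP_IntD HD Dp; have Rq := polyOverP_IntD HD Dq.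
have unit_coef (f : {poly K}) : c \in (f : seq K) -> polyOverP D ((s / c)%:P * f) ->
    ~ M (tofrac ((s / c)%:P * f)).
  move=> /(nthP 0)[k ltkf kc] Df; apply: (notinM _ k Df).
  by rewrite coefCM kc divfK.
move: cpq; rewrite mem_cat => /orP[cp|cq]; [right | left].
  exists (tofrac ((s / c)%:P * q)), (tofrac ((s / c)%:P * p)); split.
  - exact/IntDF_tofrac.
  - exact/IntDF_tofrac.
  - exact: unit_coef.
  - by rewrite hE invf_div !tofracM -mulf_div (divff te0) mul1r.
exists (tofrac ((s / c)%:P * p)), (tofrac ((s / c)%:P * q)); split.
- exact/IntDF_tofrac.
- exact/IntDF_tofrac.
- exact: unit_coef.
- by rewrite hE !tofracM -mulf_div (divff te0) mul1r.
Qed.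

Lemma tmax_IntDF_dividing : Prufer R0 -> dividing (localize R M).
Proof.
move=> pR0; have [D0P|/existsNP[x]] := EM (forall x, D0 D x -> localize D P x); last first.
  by move=> /not_implyP[D0x nPx]; exact: outside_D0_dividing D0x nPx.
apply: (overring_Prufer HR HM (IntDF_subring (D0_subring HD)) _ pR0).
  move=> h; have [a [b [Ra Rb b0 ->]]] := frR h.
  by exists a, b; split=> //; exact: IntDF_sub_D0.
move=> _ [f [D0f ->]]; apply: IntD_contraction.
by apply: (IntD_localize HD HP (D0 := D0 D)) => // y; exact: sub_D0.
Qed.

End Conversely.

Theorem theorem3p7 (K : fieldType) (D : K -> Prop)
  (HD : is_subring D) (HK : forall x : K, inFrac D x)
  (Hloc : forall P : K -> Prop, t_maximal D P ->
            forall g : {poly K}, IntDloc D P g <-> IntD (localize D P) g) :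
  PvMD (IntDF D) <-> (PvMD D /\ Prufer (IntDF (D0 D))).
Proof.
have [properD|fieldD] := EM (exists z, ~ D z).
  have HR := IntDF_subring HD; have frR := IntDF_frac HD HK.
  split=> [vR|[vD pR0] M tM].
    split; first exact: (PvMD_contract HD HK properD Hloc vR).
    exact: (Prufer_D0 HD HK properD Hloc vR).
  have HM := tmax_prime HR frR (IntDF_proper D) tM.
  apply/(valuation_dividing HR HM frR).
  exact: (tmax_IntDF_dividing HD HK properD Hloc tM vD pR0).
(* Now [D = K] and [D_0 = K], so both rings of integer-valued polynomials are [K[X]]. *)
have {}fieldD z : D z by apply: contrapT => nDz; apply: fieldD; exists z.
have fieldD0 z : D0 D z by move=> P LP; exact: (sub_localize HD (lambda0_prime LP) (fieldD z)).
split=> [_|_ M [Mid M1 _ _]]; [split=> [m [_ m1 _ _] x _ _|N [Nid N1 _]]|].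
- by left; exists x, 1; split=> //; rewrite divr1.
- by apply: polys_valuation Nid N1 => g; apply/IntDF_tofrac => x _.
- by apply: polys_valuation Mid M1 => g; apply/IntDF_tofrac => x _.
Qed.
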